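(* Let $(W,S)$ be a finite irreducible Coxeter system of rank $n=|S|$ with Coxeter number $h$. Let $k\ge 0$ and let $(j_1,j_2,\ldots,j_{k+1})$ be a sequence of nonnegative integers summing to $n$. If $i\in\{1,\ldots,k+1\}$ is an index with $j_i=1$, then \[\operatorname{C}_{(j_1,j_2,\ldots,j_{k+1})}(W)\,=\,\frac{h}{2}\,\sum_{s\in S}\operatorname{C}_{(j_1,j_2,\ldots,\widehat{j_i},\ldots,j_{k+1})}(W_{\langle s\rangle}),\] where $(j_1,j_2,\ldots,\widehat{j_i},\ldots,j_{k+1})$ is the sequence obtained by deleting the entry $j_i$ from $(j_1,j_2,\ldots,j_{k+1})$.
   Context: Let $(W,S)$ be a finite Coxeter system of rank $n=|S|$ and let $T$ be the set of reflections of $W$ (all conjugates of elements of $S$). The absolute length $\ell_T(w)$ of $w\in W$ is the minimal length of a word in the alphabet $T$ representing $w$; a word in $T$ for $w$ of this minimal length is a reduced $T$-word for $w$. The absolute order on $W$ sets $u\le v$ if and only if $u$ has a reduced $T$-word which is a prefix of some reduced $T$-word for $v$. A Coxeter element is $c=s_1s_2\cdots s_n$ with each element of $S$ occurring exactly once. The noncrossing partition lattice $L_W$ is the interval $[1,c]$ in the absolute order; its isomorphism type does not depend on the choice of $c$, and it is graded of rank $n$ with rank function $\ell_T$. The Coxeter number $h$ of an irreducible $W$ is the order of a Coxeter element. For a sequence $(j_1,\ldots,j_{k+1})$ of nonnegative integers summing to $n$, $\operatorname{C}_{(j_1,\ldots,j_{k+1})}(W)$ is the number of multichains $x_1\le x_2\le\cdots\le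 x_k$ in $L_W$ with $\ell_T(x_1)=j_1$, $\ell_T(x_k)=n-j_{k+1}$, and $\ell_T(x_p)=\ell_T(x_{p-1})+j_p$ for $p=2,\ldots,k$. For $k=0$ this number is $1$ (the empty multichain), and for the trivial group and the empty sequence it is taken to be $1$. For $s\in S$, $W_{\langle s\rangle}$ denotes the parabolic subgroup of $W$ generated by $S\setminus\{s\}$, regarded as a Coxeter system of rank $n-1$ with simple reflections $S\setminus\{s\}$ (possibly reducible or trivial). *)

(* Defs.v *)
From HB Require Import structures.
From mathcomp Require Import all_boot all_order all_fingroup all_algebra.

Set Implicit Arguments.
Unset Strict Implicit.
Unset Printing Implicit Defensive.

Local Open Scope group_scope.

(* The first two clauses and the Coxeter relations, which hold in W by the    *)
(* definition of the order #[s * t], say that W is a quotient of the group    *)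
(* presented by < S | (s t)^#[s t] = 1 >; the last clause says that W has the *)
(* universal property of that presentation, among all (possibly infinite)     *)
(* groups. The case s = t gives the relations f s ^+ 2 = 1.                   *)
Definition coxeter_system (gT : finGroupType) (W : {group gT}) (S : {set gT}) :
    Prop :=
  [/\ <<S>> = W,
      {in S, forall s, #[s] = 2} &
      forall (G : groupType) (f : gT -> G),
        {in S &, forall s t, (f s * f t) ^+ #[s * t] = 1} ->
        exists2 phi : gT -> G,
          {in W &, {morph phi : x y / x * y}} & {in S, phi =1 f}].

Definition coxeter_graph (gT : finGroupType) (S : {set gT}) : rel gT :=
  [rel s t | [&& s \in S, t \in S & 2 < #[s * t]]].

Definition irreducible_coxeter (gT : finGroupType) (S : {set gT}) : Prop :=
  S != set0 /\ {in S &, forall s t, connect (coxeter_graph S) s t}.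

Definition coxeter_element (gT : finGroupType) (S : {set gT}) (c : gT) : Prop :=
  exists2 p : seq gT, perm_eq p (enum S) & c = \prod_(s <- p) s.

Definition coxeter_number (gT : finGroupType) (S : {set gT}) (h : nat) : Prop :=
  exists2 c : gT, coxeter_element S c & h = #[c].

Definition reflections (gT : finGroupType) (W S : {set gT}) : {set gT} :=
  class_support S W.

Section AbsoluteOrder.

Variables (gT : finGroupType) (T : {set gT}).

Definition is_word (w : gT) (t : seq gT) : bool :=
  all (mem T) t && (\prod_(x <- t) x == w).

Definition has_word (w : gT) (m : nat) : bool :=
  [exists t : m.-tuple gT, is_word w t].

Lemma abs_length_ex (w : gT) : exists m, has_word w m || (w \notin <<T>>).
Proof.
have [/gen_prodgP[m [x Tx ->]]|_] := boolP (w \in <<T>>); last first.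
  by exists 0; rewrite orbT.
exists m; apply/orP; left; apply/existsP; exists [tuple x i | i < m].
apply/andP; split; first by apply/allP=> _ /mapP[i _ ->]; apply: Tx.
by rewrite big_tuple; apply/eqP/eq_bigr=> i _; rewrite tnth_mktuple.
Qed.

(* Minimal length of a word in T for w; the junk value is 0 if w is not in    *)
(* the group generated by T.                                                  *)
Definition abs_length (w : gT) : nat := ex_minn (abs_length_ex w).

Definition abs_le (u v : gT) : bool :=
  [exists a : (abs_length u).-tuple gT, exists b : (abs_length v).-tuple gT,
    [&& is_word u a, is_word v b & prefix a b]].

End AbsoluteOrder.

Definition NC (gT : finGroupType) (W S : {set gT}) (c : gT) : {set gT} :=
  let T := reflections W S in [set x in W | abs_le T 1 x && abs_le T x c].

(* With k = (size j).-1, the k-tuple x lists x_1, ..., x_k and the sequence j *)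
(* lists j_1, ..., j_(k+1); both are indexed from 0. No condition is imposed  *)
(* on the empty tuple.                                                        *)
Definition is_multichain (gT : finGroupType) (W S : {set gT}) (c : gT)
    (j : seq nat) (x : (size j).-1.-tuple gT) : bool :=
  let T := reflections W S in
  let k := (size j).-1 in
  [&& all (mem (NC W S c)) x,
      sorted (abs_le T) x,
      [forall p : 'I_k,
        abs_length T (nth 1%g x p) ==
          (if p == 0 :> nat then nth 0 j 0
           else abs_length T (nth 1%g x p.-1) + nth 0 j p)%N] &
      (0 < k) ==> (abs_length T (nth 1%g x k.-1) == #|S| - nth 0 j k)%N].

(* C_j(W), computed in the interval [1, c] for the Coxeter element c.         *)
Definition num_multichains (gT : finGroupType) (W S : {set gT}) (c : gT)
    (j : seq nat) : nat :=
  if j is [::] then 1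
  else #|[set x : (size j).-1.-tuple gT | is_multichain W S c x]|.

Definition delete_nth (i : nat) (j : seq nat) : seq nat :=
  take i j ++ drop i.+1 j.

(* Main.v *)
(** Multichains x_1 <= ... <= x_k in [1, c] with rank jumps j are factorizations
    c = w_1 ... w_(k+1) with reflection lengths j_p.  Hurwitz moves bring the
    factor of length 1 to the front, so C_j(W) is the sum over all reflections t
    of the number f(t) of factorizations of t c; f is invariant under
    conjugation by c.  If c = s_1 ... s_n and t_i = s_1 ... s_i ... s_1, then
    t_i c is a Coxeter element of the parabolic subgroup omitting s_i, and its
    minimal reflection factorizations stay in that subgroup (compare the moved
    spaces in the geometric representation).  It remains to see that the n h
    conjugates c^(-k) t_i c^k, 0 <= k < h, run through every reflection exactly
    twice, i.e. that the n h corresponding roots are all the roots, once each.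

    A finite Coxeter graph is a forest, so all Coxeter elements are conjugate
    and c may be taken bipartite.  Every c-orbit of roots sums to zero, hence
    contains a positive root made negative by the next turn, which is one of the
    n base roots.  Conversely, apply the two halves of c alternately to the
    simple roots, writing the results as rows of matrices V_k: these satisfy
    V_(k+2) = M V_(k+1) - V_k for the symmetric nonnegative matrix M = 2 - Gram.
    Each V_k is a polynomial in M with sign-coherent rows, so by irreducibility
    all its rows have the same sign, and the signs are periodic with half period
    h: no base root recurs before h turns. *)

From HB Require Import structures.
Require Import Defs.
From mathcomp Require Import all_boot all_order all_fingroup all_algebra.
From mathcomp Require Import cyclic algC.
From mathcomp Require Import zify ring lra.

Set Implicit Arguments.
Unset Strict Implicit.
Unset Printing Implicit Defensive.

Import Order.TTheory GRing.Theory Num.Theory.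

(** * Reflection length and factorizations *)

Section AbsoluteLength.

Local Open Scope group_scope.

Variables (gT : finGroupType) (T : {set gT}).

Local Notation len := (abs_length T).

Lemma has_wordP w m :
  reflect (exists t, [/\ size t = m, all (mem T) t & \prod_(x <- t) x = w])
          (has_word T w m).
Proof.
apply: (iffP existsP) => [[t /andP[Tt /eqP <-]]|[t [szt Tt <-]]].
  by exists t; rewrite size_tuple.
have /eqP szt' := szt; exists (Tuple szt').
by rewrite /is_word Tt /=.
Qed.

Lemma abs_length_le t : all (mem T) t -> len (\prod_(x <- t) x) <= size t.
Proof.
move=> Tt; rewrite /abs_length; case: ex_minnP => m _; apply.
by apply/orP; left; apply/has_wordP; exists t.
Qed.

Lemma abs_lengthP w : w \in <<T>> ->
  exists t, [/\ size t = len w, all (mem T) t & \prod_(x <- t) x = w].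
Proof.
move=> Tw; rewrite /abs_length; case: ex_minnP => m; rewrite Tw orbF.
by move/has_wordP.
Qed.

Lemma abs_length1 : len 1 = 0%N.
Proof. by have := @abs_length_le [::] isT; rewrite big_nil; case: (len 1). Qed.

Lemma prod_mem_gen (A : {set gT}) t :
  all (mem A) t -> \prod_(x <- t) x \in <<A>>.
Proof.
elim: t => [|x t IHt] /=; first by rewrite big_nil group1.
by case/andP=> Ax At; rewrite big_cons groupM ?IHt // mem_gen.
Qed.

Lemma abs_length_eq0 w : w \in <<T>> -> (len w == 0) = (w == 1).
Proof.
move=> Tw; apply/eqP/eqP=> [l0|->]; last exact: abs_length1.
have [t [szt _ <-]] := abs_lengthP Tw.
by move: szt; rewrite l0 => /size0nil ->; rewrite big_nil.
Qed.

Lemma abs_lengthM x y : x \in <<T>> -> y \in <<T>> -> len (x * y) <= len x + len y.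
Proof.
move=> /abs_lengthP[t [<- Tt <-]] /abs_lengthP[u [<- Tu <-]].
by rewrite -big_cat -size_cat; apply: abs_length_le; rewrite all_cat Tt.
Qed.

Lemma abs_length_mem_le x : x \in T -> len x <= 1.
Proof.
by move=> Tx; have := @abs_length_le [:: x]; rewrite big_seq1 /= Tx; apply.
Qed.

Lemma abs_length_eq1 w : 1 \notin T -> w \in <<T>> -> (len w == 1%N) = (w \in T).
Proof.
move=> T1 Tw; apply/idP/idP=> [/eqP l1|Tw1].
  have [t [szt Tt <-]] := abs_lengthP Tw; move: szt Tt; rewrite l1.
  by case: t => [|x []] //= _ /andP[Tx _]; rewrite big_seq1.
rewrite eqn_leq abs_length_mem_le // lt0n abs_length_eq0 //.
by apply: contraNneq T1 => <-.
Qed.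

Lemma prod_conjg (t : seq gT) g :
  \prod_(x <- [seq y ^ g | y <- t]) x = (\prod_(x <- t) x) ^ g.
Proof.
elim: t => [|x t IHt]; first by rewrite !big_nil conj1g.
by rewrite /= !big_cons IHt conjMg.
Qed.

Lemma abs_lengthJ_le x g : g \in 'N(T) -> x \in <<T>> -> len (x ^ g) <= len x.
Proof.
move=> nTg /abs_lengthP[t [<- Tt <-]].
rewrite -prod_conjg -(size_map (conjg^~ g)); apply: abs_length_le.
by rewrite all_map; apply: sub_all Tt => y /= Ty; rewrite memJ_norm.
Qed.

Lemma abs_lengthJ x g : g \in 'N(T) -> x \in <<T>> -> len (x ^ g) = len x.
Proof.
move=> nTg Tx; apply/eqP; rewrite eqn_leq abs_lengthJ_le //=.
rewrite -{1}(conjgK g x) abs_lengthJ_le ?groupV //.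
by rewrite memJ_norm // (subsetP (norm_gen T)).
Qed.

(** When a reduced word for [u] is stripped from one for [v], what remains is a word for [u^-1 * v],
    and subadditivity shows that it is reduced. Conversely, reduced words for [u] and [u^-1 * v] can
    be concatenated. *)
Lemma abs_leE u v : u \in <<T>> -> v \in <<T>> ->
  abs_le T u v = (len v == len u + len (u^-1 * v)).
Proof.
move=> Tu Tv; apply/idP/eqP=> [|def_lv].
  case/existsP=> a /existsP[b /and3P[/andP[Ta /eqP da] /andP[Tb /eqP db]]].
  case/prefixP=> d def_b.
  have szd : len v = len u + size d.
    by rewrite -(size_tuple b) def_b size_cat size_tuple.
  have def_d : u^-1 * v = \prod_(x <- d) x.
    by rewrite -db def_b big_cat /= da mulKg.
  have Td : all (mem T) d by move: Tb; rewrite def_b all_cat => /andP[].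
  apply/eqP; rewrite eqn_leq; apply/andP; split; last first.
    by rewrite szd leq_add2l def_d abs_length_le.
  rewrite -{1}(mulKVg u v); apply: abs_lengthM => //.
  by rewrite def_d prod_mem_gen.
have [a [sza Ta da]] := abs_lengthP Tu.
have [d [szd Td dd]] : exists t,
    [/\ size t = len (u^-1 * v), all (mem T) t & \prod_(x <- t) x = u^-1 * v].
  by apply: abs_lengthP; rewrite groupM ?groupV.
have szb : size (a ++ d) == len v by rewrite size_cat sza szd def_lv.
have /eqP sza' := sza.
apply/existsP; exists (Tuple sza'); apply/existsP; exists (Tuple szb).
rewrite /is_word /= Ta da all_cat Ta Td /= prefix_prefix andbT.
by rewrite big_cat /= da dd mulKVg !eqxx.
Qed.

(** The number of factorizations of [c] in [<<T>>] whose factors have, in order, the lengths listed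
    in [j]. Hurwitz moves act on these, which permits reordering [j]. *)
Fixpoint nfact (j : seq nat) (c : gT) : nat :=
  if j is a :: j' then
    (\sum_(w in <<T>> | len w == a) nfact j' (w^-1 * c))%N
  else c == 1.

Lemma nfactJ j c g : g \in 'N(T) -> nfact j (c ^ g) = nfact j c.
Proof.
move=> nTg; elim: j c => [|a j IHj] c /=; first by rewrite conjg_eq1.
rewrite (reindex_inj (conjg_inj g)) /=; apply: eq_big => [w|w _].
  rewrite memJ_norm ?(subsetP (norm_gen T)) //.
  by case Tw: (w \in <<T>>); rewrite //= abs_lengthJ.
by rewrite -conjVg -conjMg IHj.
Qed.

(** Hurwitz move: since [w * v ^ w = v * w], conjugating the second factor by the first exchanges
    the two, and conjugation within [<<T>>] preserves length. *)
Lemma nfact_swap a b j c : T \subset 'N(T) ->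
  nfact (a :: b :: j) c = nfact (b :: a :: j) c.
Proof.
move=> nTT; have nT w : w \in <<T>> -> w \in 'N(T).
  by apply/subsetP; rewrite gen_subG.
pose F w v := nfact j (v^-1 * (w^-1 * c)).
transitivity (\sum_(w in <<T>> | len w == a) \sum_(v in <<T>> | len v == b) F v w).
  apply: eq_bigr => w /andP[Tw _].
  rewrite (reindex_inj (conjg_inj w)) /=; apply: eq_big => [v|v _].
    rewrite memJ_norm; last by rewrite (subsetP (norm_gen T)) // nT.
    by case Tv: (v \in <<T>>); rewrite //= abs_lengthJ // nT.
  by rewrite /F conjgE !invMg invgK !mulgA mulgK.
by rewrite exchange_big.
Qed.

Lemma nfact_delete j i c : T \subset 'N(T) -> i < size j ->
  nfact j c = nfact (nth 0 j i :: delete_nth i j) c.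
Proof.
move=> nTT; elim: j i c => // a j IHj [|i] c lt_i.
  by rewrite /delete_nth take0 drop1.
rewrite -[delete_nth _ _]/(a :: delete_nth i j) nfact_swap //=.
by apply: eq_bigr => w _; rewrite (IHj i).
Qed.

Lemma nfact1 j c : 1 \notin T -> nfact (1%N :: j) c = (\sum_(t in T) nfact j (t^-1 * c)%g)%N.
Proof.
move=> T1 /=; apply: eq_bigl => t.
case Tt: (t \in <<T>>); first by rewrite abs_length_eq1.
by apply/esym/negbTE; apply: contraFN Tt => /mem_gen.
Qed.

Lemma nfact_word j d : 0 < nfact j d ->
  exists t, [/\ all (mem T) t, \prod_(x <- t) x = d & size t = sumn j].
Proof.
elim: j d => [|a j IHj] d /=.
  by case: eqP => // -> _; exists [::]; rewrite big_nil.
rewrite lt0n sum_nat_eq0 negb_forall => /existsP[w]; rewrite negb_imply -lt0n.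
case/andP=> /andP[Tw /eqP <-] /IHj[t [Tt def_t <-]].
have [u [szu Tu def_u]] := abs_lengthP Tw; exists (u ++ t).
by rewrite all_cat Tu Tt big_cat /= def_u def_t mulKVg size_cat szu.
Qed.

End AbsoluteLength.

(** Reduced words of the factors concatenate to a word for [d] with [sumn j] letters; by hypothesis
    this is the least possible number and forces all letters into [U]. So the same factorizations
    are counted on both sides, each factor having equal lengths for [T] and [U]. *)
Lemma nfact_restrict (gT : finGroupType) (T U : {set gT}) (j : seq nat) (d : gT) :
    U \subset T ->
    (forall t, all (mem T) t -> (\prod_(x <- t) x)%g = d ->
       sumn j <= size t /\ (size t = sumn j -> all (mem U) t)) ->
  nfact T j d = nfact U j d.
Proof.
move=> sUT; have allU t : all (mem U) t -> all (mem T) t.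
  by apply: sub_all => x; apply: (subsetP sUT).
elim: j d => [|a j IHj] d words //=.
rewrite big_mkcond [RHS]big_mkcond; apply: eq_bigr => w _.
have IHw u : size u = a -> all (mem T) u -> (\prod_(x <- u) x)%g = w ->
    nfact T j (w^-1 * d)%g = nfact U j (w^-1 * d)%g.
  move=> szu Tu def_w; apply: IHj => t Tt def_t.
  have [||le_sz sub_sz] := words (u ++ t); first by rewrite all_cat Tu.
    by rewrite big_cat /= def_w def_t mulKVg.
  move: le_sz sub_sz; rewrite size_cat szu leq_add2l all_cat => le_sz sub_sz.
  by split=> // szt; case/andP: (sub_sz (congr1 (addn a) szt)).
(* Here [u] spells the first factor and [t] the product of the others: if [u] had fewer than [a]
   letters, [u ++ t] would be too short. *)
have wordsW u t : size u <= a -> size t = sumn j -> all (mem T) u -> all (mem T) t ->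
    (\prod_(x <- u) x)%g = w -> (\prod_(x <- t) x)%g = (w^-1 * d)%g ->
  size u = a /\ all (mem U) u.
  move=> szu szt Tu Tt def_u def_t.
  have [||le_sz sub_sz] := words (u ++ t); first by rewrite all_cat Tu.
    by rewrite big_cat /= def_u def_t mulKVg.
  rewrite size_cat szt leq_add2r in le_sz sub_sz.
  have szu' : size u = a by apply/eqP; rewrite eqn_leq szu.
  split=> //; move: sub_sz; rewrite szu' all_cat => /(_ erefl).
  by case/andP.
have [/andP[Tw /eqP lenw]|notTw] := boolP ((w \in <<T>>%g) && _).
  have [u [szu Tu def_u]] := abs_lengthP Tw; rewrite lenw in szu.
  rewrite (IHw u) //; case: ifPn => // notUw; apply/eqP; rewrite -leqn0 leqNgt.
  apply: contra notUw => nz; have [t [Ut def_t szt]] := nfact_word nz.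
  have [_ Uu] := wordsW u t (eq_leq szu) szt Tu (allU t Ut) def_u def_t.
  have Uw : w \in <<U>>%g by rewrite -def_u prod_mem_gen.
  rewrite Uw eqn_leq -{1}def_u -szu abs_length_le //=.
  have [v [<- Uv def_v]] := abs_lengthP Uw.
  by rewrite szu -lenw -{1}def_v abs_length_le ?allU.
case: ifPn => // /andP[Uw /eqP lenw]; apply/esym/eqP; rewrite -leqn0 leqNgt.
apply: contra notTw => nz; have [t [Ut def_t szt]] := nfact_word nz.
have Tw : w \in <<T>>%g by rewrite (subsetP (genS sUT)).
have [v [szv Uv def_v]] := abs_lengthP Uw.
have [u [szu Tu def_u]] := abs_lengthP Tw.
have le_ua : size u <= a.
  by rewrite szu -lenw -szv -{1}def_v abs_length_le ?allU.
have [<- _] := wordsW u t le_ua szt Tu (allU t Ut) def_u def_t.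
by rewrite Tw szu eqxx.
Qed.

(** * Multichains as factorizations of [c] *)

Section Multichains.

Local Open Scope group_scope.

Variables (gT : finGroupType) (S : {set gT}).

Local Notation W := <<S>>.
Local Notation T := (reflections W S).
Local Notation len := (abs_length T).

Lemma sub_reflections : S \subset T.
Proof. exact: sub_class_support. Qed.

Lemma gen_reflections : <<T>> = W.
Proof.
apply/eqP; rewrite eqEsubset [X in _ && X]genS ?sub_reflections // andbT gen_subG.
by rewrite class_support_subG ?subset_gen.
Qed.

Lemma reflections_norm : W \subset 'N(T).
Proof. exact: class_support_norm. Qed.

Lemma reflections_normed : T \subset 'N(T).
Proof.
by apply: subset_trans (subset_gen T) _; rewrite gen_reflections reflections_norm.
Qed.

Variable c : gT.

(** Only the lengths of successive quotients are recorded, the last quotient running up to [c].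
    Under the length hypotheses of [jumpsE] this already implies the interval and order conditions
    of a multichain. *)
Fixpoint jumps (y : gT) (j : seq nat) (x : seq gT) : bool :=
  match x with
  | [::] => if j is [:: a] then len (y^-1 * c) == a else false
  | z :: x' =>
    if j is a :: j' then [&& z \in W, len (y^-1 * z) == a & jumps z j' x']
    else false
  end.

Hypothesis Wc : c \in W.

(** The quotients of neighbouring chain elements are the factors of [y^-1 * c]; the chain is
    recovered as the sequence of partial products, translated by [y]. *)
Lemma card_jumps y a j : y \in W ->
  #|[set x : (size j).-tuple gT | jumps y (a :: j) x]| = nfact T (a :: j) (y^-1 * c).
Proof.
elim: j a y => [|b j IHj] a y Wy; rewrite -sum1_card.
  have WyVc : y^-1 * c \in W by rewrite groupM ?groupV.
  transitivity (len (y^-1 * c) == a : nat).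
    under eq_bigl do rewrite inE.
    rewrite big_mkcond (big_pred1 (nil_tuple gT)) /=; first by case: eqP.
    by move=> x; rewrite [x]tuple0; apply/esym/eqP.
  rewrite /=.
  case: eqP => [def_a|neq_a]; last first.
    rewrite big1 // => w /andP[_ /eqP def_a]; rewrite -eq_mulVg1.
    by case: eqP => // def_w; rewrite -def_w in neq_a.
  rewrite (bigD1 (y^-1 * c)) /=; last by rewrite gen_reflections WyVc def_a eqxx.
  rewrite mulVg eqxx big1 // => w /andP[_]; rewrite -eq_mulVg1.
  by case: eqP.
transitivity (\sum_(z in W | len (y^-1 * z) == a)
                #|[set x : (size j).-tuple gT | jumps z (b :: j) x]|)%N.
  pose h (u : gT * (size j).-tuple gT) : (size (b :: j)).-tuple gT :=
    cons_tuple u.1 u.2.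
  rewrite (reindex h) /=; last first.
    exists (fun x : (size (b :: j)).-tuple gT => (thead x, behead_tuple x)).
      by case=> z x _; rewrite /h /= theadE; congr pair; apply/val_inj.
    by move=> x _; apply/val_inj; rewrite /h /=; case/tupleP: x => z x.
  under [RHS]eq_bigr do rewrite -sum1_card.
  rewrite pair_big_dep /=; apply: eq_bigl => -[z x].
  by rewrite /h !inE /= andbA.
rewrite (reindex_inj (mulgI y)) /=; apply: eq_big => [w|w /andP[Ww _]].
  by rewrite groupMl // mulKg gen_reflections.
by rewrite IHj ?invMg ?mulgA.
Qed.

Hypothesis lenc : len c = #|S|.

Lemma jumps_length y j x : y \in W -> jumps y j x -> len (y^-1 * c) <= sumn j.
Proof.
elim: x y j => [|z x IHx] y [|a j] Wy //=; first by case: j => //= /eqP ->; rewrite addn0.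
case/and3P=> Wz /eqP <- /(IHx _ _ Wz) le_j.
have -> : y^-1 * c = (y^-1 * z) * (z^-1 * c) by rewrite mulgA mulgK.
apply: leq_trans (abs_lengthM _ _) _; rewrite ?gen_reflections ?groupM ?groupV //.
by rewrite leq_add2l.
Qed.

(** The quotient lengths sum to [#|S|], the length of [c], so subadditivity leaves no slack: each of
    them is exactly a difference of lengths, which by [abs_leE] is the order relation. *)
Lemma jumpsE y j x : y \in W -> (len y + len (y^-1 * c) = #|S|)%N ->
    (len y + sumn j = #|S|)%N -> size j = (size x).+1 ->
  [&& all (mem (NC W S c)) x, path (abs_le T) y x,
      [forall p : 'I_(size x),
         len (nth 1%g (y :: x) p.+1) == (len (nth 1%g (y :: x) p) + nth 0 j p)%N] &
      len (last y x) == #|S| - nth 0 j (size x)] = jumps y j x.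
Proof.
have lenE u v : u \in W -> v \in W -> abs_le T u v = (len v == len u + len (u^-1 * v))%N.
  by move=> Wu Wv; rewrite abs_leE ?gen_reflections.
elim: x y j => [|z x IHx] y [|a j] //= Wy lenyc lenyj [szj].
  case: j szj lenyj => //= _; rewrite addn0 => lenyj.
  have -> : len (y^-1 * c) = a by lia.
  rewrite eqxx -lenyj addnK eqxx andbT; apply/forallP; case=> //.
rewrite /NC inE.
have -> : [forall p : 'I_(size x).+1,
   len (nth 1%g (z :: x) p) == (len (nth 1%g (y :: z :: x) p) + nth 0 (a :: j) p)%N] =
   (len z == len y + a)%N && [forall p : 'I_(size x),
      len (nth 1%g (z :: x) p.+1) == (len (nth 1%g (z :: x) p) + nth 0 j p)%N].
  apply/forallP/andP=> [eqp|[eq0 /forallP eqp] p].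
    by split; [apply: (eqp ord0) | apply/forallP=> p; apply: (eqp (lift ord0 p))].
  by case: (unliftP ord0 p) => [p' ->|->] //; apply: eqp.
have [Wz|//] := boolP (z \in W); rewrite !lenE ?group1 // invg1 mul1g abs_length1.
rewrite eqxx /=.
have [lenz|neq_lenz] := eqVneq (len z) (len y + a)%N; last first.
  (* Otherwise [len z] is smaller than [len y + a], and the remaining jumps are too short to reach
     length [#|S|] at [c]. *)
  rewrite /= !andbF; apply/esym/negP=> /andP[/eqP lenyz /(jumps_length Wz) lezc].
  have := @abs_lengthM _ T z (z^-1 * c).
  rewrite mulKVg lenc gen_reflections Wz groupM ?groupV // => /(_ isT isT).
  have := @abs_lengthM _ T y (y^-1 * z).
  rewrite mulKVg gen_reflections Wy groupM ?groupV // => /(_ isT isT).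
  rewrite lenyz leq_eqVlt (negPf neq_lenz) /= => ltz lez.
  have := leq_trans lez (leq_add (leqnn _) lezc).
  by rewrite leqNgt -lenyj addnA ltn_add2r ltz.
rewrite lenz eqn_add2l lenc [a == _]eq_sym.
have [lenyz|] := eqVneq (len (y^-1 * z)) a; last by rewrite !andbF.
have [lenzc|neq_lenzc] := eqVneq #|S| _; last first.
  rewrite /=; apply/esym/negP => /(jumps_length Wz) lezc.
  have := @abs_lengthM _ T z (z^-1 * c).
  rewrite mulKVg lenc gen_reflections Wz groupM ?groupV // => /(_ isT isT).
  rewrite lenz leq_eqVlt (negPf neq_lenzc) /= -lenyj -addnA !ltn_add2l.
  by rewrite ltnNge lezc.
rewrite /= -IHx ?lenz //; first by rewrite -addnA.
Qed.

Lemma num_multichainsE j : sumn j = #|S| -> num_multichains W S c j = nfact T j c.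
Proof.
case: j => [|a j] sumj.
  (* For the empty sequence [#|S|] is 0, so [c] has length 0 and is 1; both sides equal 1. *)
  rewrite /= -(abs_length_eq0 (T := T)) ?gen_reflections // lenc -sumj.
  by [].
rewrite /num_multichains -[in RHS](mul1g c) -invg1 -card_jumps ?group1 //.
apply: eq_card => x; rewrite !inE -jumpsE ?group1 ?size_tuple ?abs_length1 //; last first.
  by rewrite invg1 mul1g.
rewrite /is_multichain.
have [NCx|//] := boolP (all (mem (NC W S c)) x).
rewrite !andTb; congr [&& _, _ & _].
- case: (x : seq gT) NCx => //= z x' /andP[].
  by rewrite inE => /and3P[_ -> _].
- by apply: eq_forallb => p; case: (p : nat) => //=; rewrite abs_length1.
case: j x sumj {NCx} => [|b j] x sumj /=.
  by rewrite [x]tuple0 /= abs_length1 -sumj /= addn0 subnn.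
by rewrite (last_nth 1) size_tuple; case/tupleP: x => z x.
Qed.

End Multichains.

(** * Coxeter words in a forest *)

Section CoxeterMoves.

Local Open Scope group_scope.

Variable gT : finGroupType.
Implicit Types (p q r : seq gT) (a b s x : gT).

(** Swapping commuting neighbours keeps the product of a word, and a rotation conjugates it by the
    rotated letter. In a forest these moves connect all orderings of the generators. *)
Inductive cmove : seq gT -> seq gT -> Prop :=
| cmove_refl p : cmove p p
| cmove_trans p q r : cmove p q -> cmove q r -> cmove p r
| cmove_swap p a b q : commute a b -> cmove (p ++ a :: b :: q) (p ++ b :: a :: q)
| cmove_rot a p : cmove (a :: p) (rcons p a).

Lemma cmove_perm p q : cmove p q -> perm_eq p q.
Proof.
elim=> {p q} // [p q r _ pq _|p a b q _|a p]; first exact: perm_trans.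
  by rewrite perm_cat2l -[a :: _]/([:: a] ++ [:: b] ++ q) perm_catCA.
by rewrite perm_sym perm_rcons.
Qed.

Lemma cmove_conj (A : {set gT}) p q : cmove p q -> all (mem A) p ->
  exists2 g, g \in <<A>> & \prod_(x <- q) x = (\prod_(x <- p) x) ^ g.
Proof.
elim=> {p q} [p|p q r pq IHpq _ IHqr|p a b q ab|a p] Ap.
- by exists 1; rewrite ?group1 ?conjg1.
- have [g Ag def_q] := IHpq Ap; rewrite (perm_all _ (cmove_perm pq)) in Ap.
  have [g' Ag' ->] := IHqr Ap; exists (g * g'); first exact: groupM.
  by rewrite def_q conjgM.
- exists 1; rewrite ?group1 ?conjg1 // !big_cat !big_cons /=.
  by rewrite (mulgA b) -ab -(mulgA a).
exists a; first by rewrite mem_gen //; case/andP: Ap.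
by rewrite -cats1 big_cat big_seq1 big_cons conjgE -mulgA mulKg.
Qed.

Lemma cmove_bubble q p s r : {in p, forall x, commute s x} ->
  cmove (q ++ p ++ s :: r) (q ++ s :: p ++ r).
Proof.
elim: p q => [|x p IHp] q comm_s /=; first exact: cmove_refl.
have comm_p : {in p, forall y, commute s y}.
  by move=> y py; apply: comm_s; rewrite inE py orbT.
apply: (cmove_trans (q := q ++ x :: s :: p ++ r)).
  by have := IHp (rcons q x) comm_p; rewrite !cat_rcons.
by apply/cmove_swap/commute_sym/comm_s/mem_head.
Qed.

Lemma cmove_catC p q : cmove (p ++ q) (q ++ p).
Proof.
elim: p q => [|x p IHp] q; first by rewrite cats0; apply: cmove_refl.
apply: cmove_trans (cmove_rot _ _) _; rewrite -/cat rcons_cat.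
by rewrite -[q ++ _]cat_rcons.
Qed.

(* A letter s with at most one non-commuting partner a can be carried along:
   rotating a past s costs one extra turn around the word. *)
Lemma cmove_cons s a p q : cmove p q -> uniq p ->
    {in p, forall x, x != a -> commute s x} ->
  cmove (s :: p) (s :: q).
Proof.
elim=> {p q} [p|p q r pq IHpq _ IHqr|p x y q xy|x p] uniq_p comm_s.
- exact: cmove_refl.
- apply: cmove_trans (IHpq uniq_p comm_s) _; apply: IHqr.
    by rewrite -(perm_uniq (cmove_perm pq)).
  by move=> x; rewrite -(perm_mem (cmove_perm pq)); apply: comm_s.
- exact: (cmove_swap (s :: p)).
have [eq_xa|neq_xa] := eqVneq x a.
  apply: cmove_trans (cmove_rot s (x :: p)) _.
  apply: cmove_trans (cmove_rot x (rcons p s)) _.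
  rewrite -!cats1 -catA; apply: (cmove_bubble [::]) => y py.
  apply: comm_s; first by rewrite inE py orbT.
  by apply: contraTneq uniq_p => def_y; rewrite /= eq_xa -def_y py.
apply: cmove_trans (cmove_rot x (s :: p)).
by apply/(cmove_swap [::])/comm_s; rewrite ?mem_head.
Qed.

Variable S : {set gT}.
(** The noncommutation graph on [S] is a forest: every nonempty set of vertices contains one with at
    most one neighbour inside the set. *)
Hypothesis leafS : forall I : {set gT}, I \subset S -> I != set0 ->
  exists2 s, s \in I & exists a, {in I, forall x, x != s -> x != a -> commute s x}.

(** Rotate both words so that they start with the same leaf, connect the remaining letters by
    induction, and carry the leaf along with [cmove_cons]. *)
Lemma cmove_forest p q : {subset p <= S} -> uniq p -> perm_eq p q -> cmove p q.
Proof.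
have [m] := ubnP (size p); elim: m p q => // m IHm p q lt_pm pS uniq_p pq.
case: (posnP (size p)) => [/size0nil p0|p_gt0].
  by move: pq; rewrite p0 perm_sym => /perm_nilP->; apply: cmove_refl.
have [||s ps [a comm_s]] := leafS (I := [set x in p]).
- by apply/subsetP=> x; rewrite inE; apply: pS.
- by case: (p) p_gt0 => // x p' _; apply/set0Pn; exists x; rewrite inE mem_head.
rewrite inE in ps; have qs : s \in q by rewrite -(perm_mem pq).
case/splitPr: ps lt_pm pS uniq_p pq comm_s {p_gt0} => p1 p2 lt_pm pS uniq_p pq comm_s.
case/splitPr: qs pq => q1 q2 pq.
apply: cmove_trans (cmove_catC _ _) _; apply: cmove_trans (cmove_catC (s :: q2) q1).
have uniq_sp : uniq (s :: p2 ++ p1) by rewrite -cat_cons uniq_catC.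
have sub_p x : x \in p2 ++ p1 -> x \in p1 ++ s :: p2.
  by rewrite !mem_cat inE orbC => /orP[]->; rewrite ?orbT.
have [not_sp uniq_p'] := andP uniq_sp.
apply: (cmove_cons (a := a)) => //; last first.
  move=> x px; apply: comm_s; first by rewrite inE sub_p.
  by apply: contraNneq not_sp => <-.
apply: IHm => //; last first.
- move: pq; rewrite perm_catC perm_sym perm_catC /= perm_cons perm_sym.
  by [].
- by move=> x /sub_p; apply: pS.
by move: lt_pm; rewrite !size_cat /= addnS addnC ltnS.
Qed.

(** Remove a leaf, colour the rest by induction, and give the leaf the colour opposite to that of
    its only possible neighbour. *)
Lemma forest_colouring : exists col : gT -> bool,
  {in S &, forall x y, x != y -> ~~ (x * y == y * x) -> col x != col y}.
Proof.
suff col_ex (I : {set gT}) : I \subset S -> exists col : gT -> bool,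
  {in I &, forall x y, x != y -> ~~ (x * y == y * x) -> col x != col y}.
  exact: col_ex.
have [m] := ubnP #|I|; elim: m I => // m IHm I lt_Im sIS.
have [->|I_neq0] := eqVneq I set0; first by exists xpredT => x y; rewrite inE.
have [s Is [a comm_s]] := leafS sIS I_neq0.
have [||col colP] := IHm (I :\ s); first by rewrite (cardsD1 s) Is in lt_Im.
  by apply: subset_trans sIS; apply: subD1set.
exists (fun x => if x == s then ~~ col a else col x) => x y Ix Iy neq_xy ncomm.
have only_a z : z \in I -> z != s -> ~~ (s * z == z * s) -> z = a.
  by move=> Iz neq_zs; apply: contraNeq => neq_za; apply/eqP/comm_s.
have [def_x|neq_xs] := eqVneq x s; have [def_y|neq_ys] := eqVneq y s.
- by rewrite def_x def_y eqxx in neq_xy.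
- by rewrite (only_a y) // -?def_x //; case: (col a).
- by rewrite (only_a x) // -?def_y 1?eq_sym //; case: (col a).
by apply: colP; rewrite // !inE ?neq_xs ?neq_ys.
Qed.

Lemma prod_rem s p : s \in p -> {in p, forall x, commute s x} ->
  \prod_(x <- p) x = s * \prod_(x <- rem s p) x.
Proof.
elim: p => // x p IHp; rewrite inE /=; have [->|neq_xs] := eqVneq x s.
  by rewrite big_cons.
move=> /= ps comm_s; rewrite !big_cons IHp //.
  by rewrite !mulgA (comm_s x) ?mem_head.
by move=> y py; apply: comm_s; rewrite inE py orbT.
Qed.

End CoxeterMoves.

(** * Chebyshev values *)

Section Chebyshev.

Local Open Scope ring_scope.

(* chebU x k = sin (k t) / sin t for x = 2 cos t *)
Fixpoint chebU (A : comNzRingType) (x : A) (k : nat) : A :=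
  if k is k'.+1 then
    if k' is k''.+1 then x * chebU x k' - chebU x k'' else 1
  else 0.

Lemma chebUSS (A : comNzRingType) (x : A) k :
  chebU x k.+2 = x * chebU x k.+1 - chebU x k.
Proof. by []. Qed.

Lemma horner_chebU (A : comNzRingType) (x : A) k : (chebU 'X k).[x] = chebU x k.
Proof.
suff: (chebU 'X k).[x] = chebU x k /\ (chebU 'X k.+1).[x] = chebU x k.+1 by case.
elim: k => [|k [IH1 IH2]]; first by rewrite /= hornerC hornerC.
by rewrite !chebUSS !hornerE IH1 IH2.
Qed.

Lemma chebU_cassini (A : comNzRingType) (x : A) k :
  chebU x k.+1 ^+ 2 - chebU x k.+2 * chebU x k = 1.
Proof.
elim: k => [|k IHk]; first by rewrite /=; ring.
by rewrite -[RHS]IHk (chebUSS x k.+1) (chebUSS x k); ring.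
Qed.

Variable R : rcfType.
Implicit Types (x y : R) (k m : nat).

Lemma chebU2 k : chebU (2 : R) k = k%:R.
Proof.
suff: chebU (2 : R) k = k%:R /\ chebU (2 : R) k.+1 = k.+1%:R by case.
elim: k => [|k [IH1 IH2]]; first by [].
by rewrite !chebUSS IH2 IH1 -!natr1; split => //; ring.
Qed.

(** Discrete Sturm comparison: the Casoratian [D] telescopes to [y - x] times a sum of products of
    values at [x] and at [y], so positivity at [x] propagates to [y]. *)
Lemma chebU_gt0_mono m x y : x <= y ->
    (forall k, (0 < k < m)%N -> 0 < chebU x k) -> chebU x m = 0 ->
  forall k, (0 < k <= m)%N -> x < y -> 0 < chebU y k.
Proof.
move=> le_xy Ux_gt0 Uxm k /andP[k_gt0 le_km] lt_xy.
pose D k := chebU y k.+1 * chebU x k - chebU y k * chebU x k.+1.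
have DS i : D i.+1 = (y - x) * (chebU y i.+1 * chebU x i.+1) + D i.
  by rewrite /D !chebUSS; ring.
have Ux_ge0 i : (i < m)%N -> 0 <= chebU x i.+1.
  rewrite leq_eqVlt => /predU1P[->|lt_im]; first by rewrite Uxm.
  by apply/ltW/Ux_gt0.
suff: 0 < chebU y k /\ 0 <= D k.-1 by case.
case: k k_gt0 le_km => // k _; elim: k => [|k IHk] lt_km /=.
  by rewrite /D /= ltr01 mulr0 mul0r subr0.
have [Uy D_ge0] := IHk (ltnW lt_km).
have Ux : 0 < chebU x k.+1 by apply: Ux_gt0.
have D1 : 0 < D k.+1.
  by rewrite DS ltr_wpDr // !mulr_gt0 // subr_gt0.
split; last exact: ltW.
rewrite -(pmulr_lgt0 _ Ux) -[X in 0 < X](subrK (chebU y k.+1 * chebU x k.+2)).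
by rewrite ltr_wpDr // mulr_ge0 ?(ltW Uy) // Ux_ge0.
Qed.

(** An algebraic construction of 2 cos (pi / m), by induction on [m]. At the value found for [m] the
    next polynomial is minus the previous one, hence negative; at 2 it is positive by [chebU2]. A
    root lies in between, and [chebU_gt0_mono] gives the signs there. *)
Lemma chebU_root m : (1 < m)%N ->
  exists x, [/\ 0 <= x, x < 2, chebU x m = 0 &
                forall k, (0 < k < m)%N -> 0 < chebU x k].
Proof.
case: m => [|[|m]] // _; elim: m => [|m [x [x0 x2 Um Ux]]].
  exists 0; split=> //=; first by rewrite mul0r subr0.
  by case=> [|[|k]] //= _; rewrite ltr01.
have Um1 : chebU x m.+1 > 0 by apply: Ux; rewrite ltnSn.
pose p : {poly R} := chebU 'X m.+3.
have sgU : p.[x] <= 0 <= p.[2].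
  rewrite !horner_chebU chebU2 ler0n andbT chebUSS Um mulr0 sub0r.
  by rewrite oppr_le0 ltW.
have [y /andP[le_xy le_y2] /eqP/=] := poly_ivt (ltW x2) sgU.
rewrite horner_chebU => Uy.
have lt_xy : x < y.
  rewrite lt_neqAle le_xy andbT; apply: contra_eqN Uy => /eqP <-.
  by rewrite chebUSS Um mulr0 sub0r oppr_eq0 gt_eqF.
exists y; split=> //; first exact: le_trans le_xy.
  rewrite lt_neqAle le_y2 andbT; apply: contra_eqN Uy => /eqP ->.
  by rewrite chebU2 pnatr_eq0.
by move=> k lt_km; apply: (chebU_gt0_mono le_xy Ux Um).
Qed.

Lemma chebU_rootP m x : chebU x m.+1 = 0 -> 0 < chebU x m -> chebU x m = 1.
Proof.
move=> Um1 Um; have := chebU_cassini x m.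
rewrite chebUSS Um1 expr0n /= mulr0 !sub0r mulNr opprK => /eqP.
by rewrite -expr2 sqrf_eq1 => /orP[] /eqP // UmN; rewrite UmN ltr0N1 in Um.
Qed.

(** By Cassini the value just before the zero is 1, so the recursion restarts with opposite sign
    after [m.+1] steps. *)
Lemma chebU_period m x : chebU x m.+1 = 0 -> 0 < chebU x m ->
  chebU x m.+1.*2 = 0 /\ chebU x m.+1.*2.+1 = 1.
Proof.
move=> Um1 Um; have Um_1 := chebU_rootP Um1 Um.
have shift k : chebU x (m.+1 + k) = - chebU x k /\
               chebU x (m.+1 + k).+1 = - chebU x k.+1.
  elim: k => [|k [IH1 IH2]].
    by rewrite addn0 chebUSS Um1 Um_1 /= mulr0 oppr0 sub0r.
  by rewrite addnS; split=> //; rewrite (chebUSS _ (m.+1 + k)) IH1 IH2 chebUSS; ring.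
have [U1 U2] := shift m.+1.
by rewrite -addnn U1 U2 chebUSS Um1 Um_1; split; ring.
Qed.

End Chebyshev.

(** * The geometric representation *)

Section InvertibleMatrices.

Local Open Scope ring_scope.

Variables (R : comUnitRingType) (n : nat).

(** The target group for the universal property of the presentation; since [R] may be infinite, it
    is a [groupType] and not a finite group. *)
Record inv_mx := InvMx { mx_of_inv :> 'M[R]_n; _ : mx_of_inv \in unitmx }.

HB.instance Definition _ := [isSub for mx_of_inv].
HB.instance Definition _ := [Choice of inv_mx by <:].

Lemma inv_mx_unit (A : inv_mx) : val A \in unitmx. Proof. exact: valP. Qed.

Definition inv_mx1 := InvMx (unitmx1 R n).

Lemma inv_mxM_subproof (A B : inv_mx) : val A *m val B \in unitmx.
Proof. by rewrite unitmx_mul !inv_mx_unit. Qed.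

Definition inv_mxM A B := InvMx (inv_mxM_subproof A B).

Lemma inv_mxV_subproof (A : inv_mx) : invmx (val A) \in unitmx.
Proof. by rewrite unitmx_inv inv_mx_unit. Qed.

Definition inv_mxV A := InvMx (inv_mxV_subproof A).

Lemma inv_mxMA : associative inv_mxM.
Proof. by move=> A B C; apply/val_inj; rewrite /= mulmxA. Qed.

Lemma inv_mx1M : left_id inv_mx1 inv_mxM.
Proof. by move=> A; apply/val_inj; rewrite /= mul1mx. Qed.

Lemma inv_mxM1 : right_id inv_mx1 inv_mxM.
Proof. by move=> A; apply/val_inj; rewrite /= mulmx1. Qed.

Lemma inv_mxVM : left_inverse inv_mx1 inv_mxV inv_mxM.
Proof. by move=> A; apply/val_inj; rewrite /= mulVmx ?inv_mx_unit. Qed.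

Lemma inv_mxMV : right_inverse inv_mx1 inv_mxV inv_mxM.
Proof. by move=> A; apply/val_inj; rewrite /= mulmxV ?inv_mx_unit. Qed.

HB.instance Definition _ :=
  isGroup.Build inv_mx inv_mxMA inv_mx1M inv_mxM1 inv_mxVM inv_mxMV.

Lemma val_inv_mxX (A : inv_mx) k : val (A ^+ k)%g = (val A ^+ k)%R.
Proof.
elim: k => [|k IHk]; first by rewrite expg0 expr0.
by rewrite expgS exprS -IHk.
Qed.

End InvertibleMatrices.

Section GeometricRepresentation.

Local Open Scope ring_scope.

Section Coefficients.

Variable R : rcfType.

(** A boolean form of the conclusion of [chebU_root], so that [xchoose] can select a value; vacuous
    when [m] is at most 1. *)
Definition is_2cos (m : nat) (x : R) : bool :=
  (1 < m)%N ==>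
  [&& 0 <= x, x < 2, chebU x m == 0 &
      all (fun k => (k == 0%N) || (0 < chebU x k)) (iota 0 m)].

Lemma is_2cos_ex m : exists x, is_2cos m x.
Proof.
have [m_gt1|/negPf m_le1] := boolP (1 < m)%N; last by exists 0; rewrite /is_2cos m_le1.
have [x [x0 x2 Um Ux]] := chebU_root R m_gt1; exists x; rewrite /is_2cos m_gt1.
rewrite x0 x2 Um eqxx /=; apply/allP=> k; rewrite mem_iota add0n /= => lt_km.
by rewrite -leqn0 leqNgt; case: ltnP => //= k_gt0; apply: Ux; rewrite k_gt0.
Qed.

(* 2 cos (pi / m) for m > 1; arbitrary otherwise *)
Definition cos2 m : R := xchoose (is_2cos_ex m).

Section Properties.

Variable m : nat.
Hypothesis m_gt1 : (1 < m)%N.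

Lemma cos2P : [/\ 0 <= cos2 m, cos2 m < 2, chebU (cos2 m) m = 0 &
                  forall k, (0 < k < m)%N -> 0 < chebU (cos2 m) k].
Proof.
have := xchooseP (is_2cos_ex m); rewrite -/(cos2 m) /is_2cos m_gt1 /=.
case/and4P=> c0 c2 /eqP Um /allP Uk; split=> // k /andP[k0 lt_km].
have := Uk k; rewrite mem_iota /= => /(_ lt_km).
by rewrite eqn0Ngt k0.
Qed.

Lemma cos2_period : chebU (cos2 m) m.*2 = 0 /\ chebU (cos2 m) m.*2.+1 = 1.
Proof.
have [_ _ Um Uk] := cos2P; case: m m_gt1 Um Uk => // k k_gt0 Um Uk.
by apply: chebU_period => //; apply: Uk; rewrite ltnSn andbT.
Qed.

Lemma chebU_cos2_ge0 k : (k <= m)%N -> 0 <= chebU (cos2 m) k.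
Proof.
have [_ _ Um Uk] := cos2P; rewrite leq_eqVlt => /predU1P[->|lt_km].
  by rewrite Um.
by case: k lt_km => [|k lt_km]; [rewrite lexx | apply/ltW/Uk].
Qed.

(** [chebU x 3] is [x ^+ 2 - 1], and it is nonnegative at [x = cos2 m] because 3 is at most [m]. *)
Lemma cos2_ge1 : (2 < m)%N -> 1 <= cos2 m.
Proof.
move=> m_gt2; have [c0 _ _ _] := cos2P.
have := chebU_cos2_ge0 m_gt2; rewrite /= mulr1 subr0 subr_ge0 -expr2.
by rewrite -[X in X <= _](expr1n _ 2) ler_pXn2r // nnegrE.
Qed.

End Properties.

Lemma cos2_2 : cos2 2 = 0.
Proof. by have [_ _ /=] := @cos2P 2 isT; rewrite mulr1 subr0. Qed.

End Coefficients.

Variables (R : rcfType) (gT : finGroupType) (S : {set gT}).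

Local Notation n := #|S|.
Local Notation e i := (@enum_val _ (mem S) i).
Local Notation vec i := (delta_mx 0 i : 'rV[R]_n).

(** Twice the usual matrix of the canonical form, so that simple roots have norm 2 and no fractions
    appear in the reflections. Vectors are rows and matrices act on the right. *)
Definition gram : 'M[R]_n :=
  \matrix_(i, j) if i == j then 2 else - cos2 R #[e i * e j]%g.

Definition srefl (i : 'I_n) : 'M[R]_n := 1%:M - gram *m delta_mx i i.

Lemma order_mulgC (x y : gT) : #[x * y]%g = #[y * x]%g.
Proof. by rewrite -(orderJ (x * y)%g x) conjgE mulgA mulgA mulVg mul1g. Qed.

Lemma gramC i j : gram i j = gram j i.
Proof. by rewrite !mxE eq_sym order_mulgC. Qed.

Lemma gram_tr : gram^T = gram.
Proof. by apply/matrixP=> i j; rewrite mxE gramC. Qed.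

Lemma gram_id i : gram i i = 2.
Proof. by rewrite mxE eqxx. Qed.

Lemma mul_srefl (x : 'rV_n) i : x *m srefl i = x - (x *m gram) 0 i *: vec i.
Proof.
rewrite /srefl mulmxBr mulmx1 mulmxA; congr (_ - _).
apply/rowP=> j; rewrite !mxE (bigD1 i) //= big1 ?addr0.
  by rewrite !mxE !eqxx /= eq_sym.
by move=> l neq_li; rewrite !mxE (negPf neq_li) mulr0.
Qed.

Lemma vec_gram i j : (vec i *m gram) 0 j = gram i j.
Proof. by rewrite -rowE mxE. Qed.

Lemma vec_srefl i j : vec i *m srefl j = vec i - gram i j *: vec j.
Proof. by rewrite mul_srefl vec_gram. Qed.

Lemma mulmx_inj_row (A B : 'M[R]_n) : (forall x : 'rV_n, x *m A = x *m B) -> A = B.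
Proof. by move=> eqAB; apply/row_matrixP=> i; rewrite !rowE. Qed.

Lemma srefl_id i : srefl i *m srefl i = 1%:M.
Proof.
apply: mulmx_inj_row => x; rewrite mulmxA mulmx1 [x *m _]mul_srefl mulmxBl.
rewrite -scalemxAl vec_srefl gram_id mul_srefl.
by rewrite scalerBr scalerA mulr_natr mulr2n scalerDl; apply/rowP=> j; rewrite !mxE; ring.
Qed.

Lemma srefl_unit i : srefl i \in unitmx.
Proof. by have /mulmx1_unit[] := srefl_id i. Qed.

Lemma vec_dihedral i j k (a := - gram i j) : i != j ->
  vec i *m (srefl j *m srefl i) ^+ k =
  chebU a k.*2.+1 *: vec i + chebU a k.*2 *: vec j.
Proof.
move=> neq_ij; elim: k => [|k IHk].
  by rewrite expr0 mulmx1 /= scale1r scale0r addr0.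
rewrite exprSr mulmxA IHk !mulmxA !mulmxDl -!scalemxAl !vec_srefl gram_id.
rewrite !mulmxBl -!scalemxAl !vec_srefl !gram_id.
rewrite doubleS !chebUSS (gramC j i) -[gram i j]opprK -/a.
by apply/rowP=> l; rewrite !mxE; ring.
Qed.

Hypothesis S_order2 : {in S, forall s, #[s]%g = 2%N}.

Lemma gen_order i : #[e i]%g = 2%N. Proof. by rewrite S_order2 ?enum_valP. Qed.

Lemma gen_inv i : (e i)^-1%g = e i.
Proof. by apply/eqP; rewrite eq_invg_mul -expg2 -(gen_order i) expg_order. Qed.

Lemma order_gen_gt1 i j : i != j -> (1 < #[e i * e j]%g)%N.
Proof.
move=> neq_ij; rewrite order_gt1 -eq_invg_mul gen_inv.
by apply: contra neq_ij => /eqP/enum_val_inj->.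
Qed.

(** A vector splits into a part in the plane of [vec i] and [vec j], where Chebyshev periodicity
    applies, and a part orthogonal to both, which both reflections fix. The splitting exists because
    the Gram determinant [4 - a ^+ 2] of the plane is nonzero. *)
Lemma dihedral_order i j : i != j ->
  (srefl j *m srefl i) ^+ #[e i * e j]%g = 1%:M :> 'M[R]_n.
Proof.
move=> neq_ij; set m := #[_]%g; have m_gt1 : (1 < m)%N by apply: order_gen_gt1.
have mC : #[e j * e i]%g = m by rewrite order_mulgC.
have gij : gram i j = - cos2 R m by rewrite mxE (negPf neq_ij).
have [a_ge0 a_lt2 _ _] := @cos2P R m m_gt1.
have [U0 U1] := @cos2_period R m m_gt1.
set B := _ ^+ m.
have viB : vec i *m B = vec i.
  by rewrite vec_dihedral // gij opprK U0 U1 scale1r scale0r addr0.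
(* The inverse product is the one for which [vec j] is in the position of [vec i]. *)
have vjB : vec j *m B = vec j.
  have eq_j : vec j *m (srefl i *m srefl j) ^+ m = vec j.
    rewrite vec_dihedral 1?eq_sym // gramC gij opprK U0 U1.
    by rewrite scale1r scale0r addr0.
  rewrite -[in LHS]eq_j -mulmxA; suff -> : (srefl i *m srefl j) ^+ m *m B = 1%:M.
    by rewrite mulmx1.
  rewrite /B; elim: (m) => [|k IHk]; first by rewrite !expr0 mulmx1.
  transitivity ((srefl i *m srefl j) ^+ k *m
    (srefl i *m (srefl j *m srefl j) *m srefl i) *m (srefl j *m srefl i) ^+ k).
    by rewrite exprSr [X in _ *m X]exprS -!mulmxE !mulmxA.
  by rewrite srefl_id mulmx1 srefl_id mulmx1 IHk.
apply: mulmx_inj_row => x; rewrite mulmx1.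
set a := cos2 R m in gij a_ge0 a_lt2.
have D_neq0 : 4 - a ^+ 2 != 0 :> R.
  by rewrite gt_eqF //; nra.
pose X k := (x *m gram) 0 k.
(* Cramer's rule for the two conditions that [z] be orthogonal to [vec i] and [vec j]. *)
pose p := (2 * X i + a * X j) / (4 - a ^+ 2).
pose q := (2 * X j + a * X i) / (4 - a ^+ 2).
pose z := x - p *: vec i - q *: vec j.
have zgram k : (z *m gram) 0 k = X k - p * gram i k - q * gram j k.
  rewrite /z !mulmxBl -!scalemxAl -(vec_gram i) -(vec_gram j) /X.
  by rewrite -!scaleNr; move: (_ *m _) (vec i *m _) (vec j *m _) => u v w; rewrite !mxE; ring.
have zi : (z *m gram) 0 i = 0.
  by rewrite zgram gram_id (gramC j i) gij /p /q; field.
have zj : (z *m gram) 0 j = 0.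
  by rewrite zgram gram_id gij /p /q; field.
have zB : z *m B = z.
  rewrite /B; elim: (m) => [|k IHk]; first by rewrite expr0 mulmx1.
  rewrite exprS mulmxA mulmxA [z *m srefl j]mul_srefl zj scale0r subr0.
  by rewrite mul_srefl zi scale0r subr0.
have def_x : x = z + q *: vec j + p *: vec i by rewrite /z !subrK.
clear zgram zi zj; clearbody z.
by rewrite [in LHS]def_x !mulmxDl -!scalemxAl zB viB vjB -def_x.
Qed.

Lemma geometric_representation :
    (forall (G : groupType) (f : gT -> G),
      {in S &, forall s t, (f s * f t) ^+ #[s * t] = 1}%g ->
      exists2 phi : gT -> G,
        {in <<S>> &, {morph phi : x y / x * y}}%g & {in S, phi =1 f}) ->
  exists rho : gT -> 'M[R]_n,
    [/\ {in <<S>>%g &, forall x y, rho (x * y)%g = rho x *m rho y},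
        rho 1%g = 1%:M & forall i, rho (e i) = srefl i].
Proof.
move=> univ.
pose refl i : inv_mx R n := InvMx (srefl_unit i).
pose f s : inv_mx R n := if [pick i | e i == s] is Some i then refl i else 1%g.
have fe i : f (e i) = refl i.
  rewrite /f; case: pickP => [j /eqP/enum_val_inj->|/(_ i)] //.
  by rewrite eqxx.
have [s t Ss St|phi phiM phiS] := univ _ f.
  rewrite -(enum_rankK_in Ss Ss) -(enum_rankK_in St St).
  set i := enum_rank_in _ s; set j := enum_rank_in _ t.
  rewrite !fe; apply/val_inj; rewrite val_inv_mxX /=.
  have [->|neq_ij] := eqVneq i j.
    by rewrite -expg2 -(gen_order j) expg_order order1 expr1 srefl_id.
  by rewrite order_mulgC dihedral_order // eq_sym.
exists (fun w => val (phi w)); split=> [x y Wx Wy||i].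
- by rewrite phiM.
- have := phiM 1%g 1%g (group1 _) (group1 _); rewrite mulg1.
  by move/esym/(canRL (mulKg _)); rewrite mulVg => ->.
by rewrite phiS ?fe ?enum_valP.
Qed.

End GeometricRepresentation.

(** * Roots *)

Section AlternatingWords.

Local Open Scope group_scope.

Variables (gT : finGroupType).
Implicit Types (x y : gT) (k : nat).

(* the alternating word x y x y ... with k letters *)
Definition altw x y k := (x * y) ^+ k./2 * x ^+ odd k.

Lemma altw0 x y : altw x y 0 = 1. Proof. by rewrite /altw !expg0 mulg1. Qed.

Lemma altwSr x y k : altw x y k.+1 = altw x y k * (if odd k then y else x).
Proof.
rewrite /altw /= uphalf_half; case: (odd k) => /=; last by rewrite add0n expg0 mulg1.
by rewrite add1n expgSr expg0 expg1 mulg1 !mulgA.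
Qed.

Lemma altwSl x y k : altw x y k.+1 = x * altw y x k.
Proof.
elim: k => [|k IHk]; first by rewrite altwSr !altw0 mulg1 mul1g.
by rewrite altwSr IHk [altw y x k.+1]altwSr -!mulgA oddS; case: (odd k).
Qed.

(** The relation [(x * y) ^+ #[x * y] = 1] with half of its letters moved to the other side. *)
Lemma altw_braid x y : x^-1 = x -> y^-1 = y ->
  altw x y #[x * y] = altw y x #[x * y].
Proof.
move=> xV yV; set m := #[_].
have xyV : (x * y)^-1 = y * x by rewrite invMg xV yV.
have: (x * y) ^+ m = 1 by apply: expg_order.
rewrite /altw -{1}(odd_double_half m) -addnn.
rewrite -xyV expgVn; set u := _ ^+ m./2.
case: (odd m) => /=; rewrite ?expg1 ?expg0 ?mulg1.
  rewrite add1n expgS expgD -/u mulgA => /(canRL (mulgK u)); rewrite mul1g => <-.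
  have -> : (x * y) * u = u * (x * y) by rewrite -expgS expgSr.
  by rewrite -!mulgA -{2}yV mulgV mulg1.
by rewrite add0n expgD => /(canRL (mulgK _)); rewrite mul1g.
Qed.

End AlternatingWords.

Local Arguments chebU : simpl never.

Section Roots.

Local Open Scope ring_scope.

Variables (R : rcfType) (gT : finGroupType) (S : {set gT}).

Local Notation n := #|S|.
Local Notation W := <<S>>%g.
Local Notation e i := (@enum_val _ (mem S) i).
Local Notation vec i := (delta_mx 0 i : 'rV[R]_n).
Local Notation gram := (gram R S).
Local Notation srefl := (@srefl R gT S).
(** The alphabet is now [S]: this is the Coxeter length, not the reflection length. *)
Local Notation len := (abs_length S).

Hypothesis S_order2 : {in S, forall s, #[s]%g = 2%N}.

Variable rho : gT -> 'M[R]_n.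
Hypothesis rhoM : {in W &, forall x y, rho (x * y)%g = rho x *m rho y}.
Hypothesis rho1 : rho 1%g = 1%:M.
Hypothesis rho_gen : forall i : 'I_n, rho (e i) = srefl i.

Lemma gen_mem i : e i \in W.
Proof. by rewrite mem_gen ?enum_valP. Qed.

Local Hint Resolve gen_mem : core.

Lemma gen_sqr i : (e i * e i)%g = 1%g.
Proof. by rewrite -{1}(gen_inv S_order2) mulVg. Qed.

Lemma gen_mulK i w : (e i * (e i * w))%g = w.
Proof. by rewrite mulgA gen_sqr mul1g. Qed.

Lemma gen_ind (P : gT -> Prop) : P 1%g ->
    (forall i w, w \in W -> P w -> P (e i * w)%g) ->
  forall w, w \in W -> P w.
Proof.
move=> P1 PM w /abs_lengthP[t [_ St <-]].
elim: t St => [|s t IHt] /=; first by rewrite big_nil.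
case/andP=> Ss St; rewrite big_cons -(enum_rankK_in Ss Ss).
by apply: PM; [apply: prod_mem_gen | apply: IHt].
Qed.

Lemma rhoVl w : w \in W -> rho w^-1%g *m rho w = 1%:M.
Proof. by move=> Ww; rewrite -rhoM ?groupV // mulVg rho1. Qed.

Lemma rhoVr w : w \in W -> rho w *m rho w^-1%g = 1%:M.
Proof. by move=> Ww; rewrite -rhoM ?groupV // mulgV rho1. Qed.

Lemma rho_genM i w : w \in W -> rho (e i * w)%g = srefl i *m rho w.
Proof. by move=> Ww; rewrite rhoM // rho_gen. Qed.

Lemma len_genM i w : w \in W -> (len (e i * w)%g <= (len w).+1)%N.
Proof.
move=> Ww; apply: leq_trans (abs_lengthM _ _) _ => //.
by rewrite -add1n leq_add2r abs_length_mem_le ?enum_valP.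
Qed.

Lemma len_genM_ge i w : w \in W -> (len w <= (len (e i * w)%g).+1)%N.
Proof. by move=> Ww; rewrite -{1}(gen_mulK i w) len_genM ?groupM. Qed.

Lemma altw_mem i j k : altw (e i) (e j) k \in W.
Proof. by rewrite groupM ?groupX ?groupM. Qed.

Lemma len_altwM i j k w : w \in W -> (len (altw (e i) (e j) k * w)%g <= k + len w)%N.
Proof.
move=> Ww; elim: k i j => [|k IHk] i j; first by rewrite altw0 mul1g.
rewrite altwSl -mulgA addSn; apply: leq_trans (len_genM _ _) _; last exact: IHk.
by rewrite groupM ?altw_mem.
Qed.

Lemma vec_altw i j k (a := - gram i j) : i != j ->
  vec i *m rho (altw (e j) (e i) k) =
  if odd k then chebU a k *: vec i + chebU a k.+1 *: vec j
  else chebU a k.+1 *: vec i + chebU a k *: vec j.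
Proof.
move=> neq_ij.
have rhoX l : rho ((e j * e i) ^+ l)%g = (srefl j *m srefl i) ^+ l.
  elim: l => [|l IHl]; first by rewrite expg0 expr0.
  by rewrite expgS rhoM ?groupX ?groupM // exprS -IHl rhoM // !rho_gen.
have even_case l : vec i *m rho (altw (e j) (e i) l.*2) =
    chebU a l.*2.+1 *: vec i + chebU a l.*2 *: vec j.
  by rewrite /altw odd_double doubleK expg0 mulg1 rhoX vec_dihedral.
rewrite -(odd_double_half k); case: (odd k) (k./2) => l /=; last first.
  by rewrite odd_double add0n even_case.
rewrite add1n /= odd_double /= altwSr odd_double rhoM ?altw_mem // mulmxA.
rewrite even_case rho_gen mulmxDl -!scalemxAl !vec_srefl gram_id.
rewrite (chebUSS _ l.*2) -[gram i j]opprK -/a.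
by apply/rowP=> u; rewrite !mxE; ring.
Qed.

Definition nneg (x : 'rV[R]_n) := [forall j, 0 <= x 0 j].

Lemma nnegP (x : 'rV_n) : reflect (forall j, 0 <= x 0 j) (nneg x).
Proof. exact: forallP. Qed.

Lemma nneg_vec i : nneg (vec i).
Proof. by apply/nnegP=> j; rewrite mxE ler0n. Qed.

Lemma nneg_comb (a b : R) (x y : 'rV_n) : 0 <= a -> 0 <= b -> nneg x -> nneg y ->
  nneg (a *: x + b *: y).
Proof.
move=> a0 b0 /nnegP x0 /nnegP y0; apply/nnegP=> j.
by rewrite !mxE addr_ge0 ?mulr_ge0.
Qed.

Lemma descent w : w \in W -> w != 1%g -> exists j, (len (e j * w)%g < len w)%N.
Proof.
move=> Ww neq_w1; have [[|s t] [szt St def_w]] := abs_lengthP Ww.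
  by move: neq_w1; rewrite -def_w big_nil eqxx.
case/andP: St => Ss St; exists (enum_rank_in Ss s).
rewrite enum_rankK_in // -{1}def_w big_cons -szt mulgA.
rewrite -[s in (s * s)%g](enum_rankK_in Ss Ss) gen_sqr mul1g ltnS.
exact: abs_length_le.
Qed.

(* Strip e_j and e_i alternately from the left of w as long as the length
   drops: what remains is shorter and not shortened by either of them, and the
   stripped dihedral word acts by chebU coefficients, nonnegative below the
   order of e_j e_i. *)
Lemma root_nneg i w : w \in W -> ~~ (len (e i * w)%g < len w)%N ->
  nneg (vec i *m rho w).
Proof.
have [m] := ubnP (len w); elim: m i w => // m IHm i w lt_wm Ww len_iw.
have [w1|neq_w1] := eqVneq w 1%g.
  by rewrite w1 rho1 mulmx1 nneg_vec.
have [j len_jw] := descent Ww neq_w1.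
have neq_ij : i != j by apply: contraNneq len_iw => ->.
pose v k := ((altw (e j) (e i) k)^-1 * w)%g.
have Wv k : v k \in W by rewrite groupM ?groupV ?altw_mem.
have wE k : w = (altw (e j) (e i) k * v k)%g by rewrite mulKVg.
have vS k : v k.+1 = ((if odd k then e i else e j) * v k)%g.
  by rewrite /v altwSr invMg; case: odd; rewrite (gen_inv S_order2) mulgA.
pose P k := (len (v k) + k == len w)%N.
have P1 : P 1%N.
  rewrite /P vS /v altw0 invg1 mul1g /= addn1 eqn_leq len_jw.
  exact: len_genM_ge.
have exP : exists k, P k by exists 1%N.
have leP k : P k -> (k <= len w)%N by move/eqP <-; rewrite leq_addl.
have [k Pk maxk] := ex_maxnP exP leP.
have k_gt0 : (0 < k)%N by apply: maxk.
have /eqP lenv := Pk.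
have lt_vw : (len (v k) < m)%N.
  move: lt_wm; rewrite -lenv ltnS; apply: leq_trans.
  by rewrite -addn1 leq_add2l.
(* Neither of the two generators shortens [v k]: one would lead to [v k.+1], against the maximality
   of [k], and the other leads back to the longer [v k.-1]. *)
have next_ge : ~~ (len (v k.+1) < len (v k))%N.
  apply/negP=> lt_v; suff /maxk: P k.+1 by rewrite ltnn.
  rewrite /P -lenv addnS -addSn eqn_add2r eqn_leq lt_v.
  by rewrite vS; case: odd; rewrite len_genM_ge.
have v_prev l : v l = ((if odd l then e i else e j) * v l.+1)%g.
  by rewrite vS; case: odd; rewrite gen_mulK.
have len_prev d : (d <= k)%N -> (len (v (k - d)%N) <= len (v k) + d)%N.
  elim: d => [|d IHd] lt_dk; first by rewrite subn0 addn0.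
  rewrite v_prev -subSn // subSS addnS; apply: leq_trans (_ : _ <= (len (v (k - d)%N)).+1)%N _.
    by case: odd; rewrite len_genM.
  by rewrite ltnS IHd // ltnW.
have prev_ge : ~~ (len (v k.-1) < len (v k))%N.
  apply/negP=> lt_v; have := len_altwM j i k.-1 (Wv k.-1).
  by rewrite -wE; lia.
(* If the stripped word were as long as the order of [e j * e i], the braid relation would make it
   start with [e i], and [e i] would shorten [w]. *)
have k_lt : (k < #[e j * e i]%g)%N.
  rewrite ltnNge; apply: contra len_iw; set o := #[_]%g => le_ok.
  have o_gt0 : (0 < o)%N by apply: order_gt0.
  have lenvo : (len (v o) <= len (v k) + (k - o))%N.
    by rewrite -{1}(subKn le_ok) len_prev // leq_subr.
  rewrite [X in (e i * X)%g](wE o) altw_braid ?gen_inv //.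
  rewrite -/o -{1}(prednK o_gt0) altwSl -mulgA gen_mulK.
  apply: leq_trans (_ : (o.-1 + len (v o)).+1 <= _)%N.
    by rewrite ltnS; apply: len_altwM.
  rewrite -addSn prednK // -lenv -{2}(subnKC le_ok) addnCA leq_add2l.
  exact: lenvo.
have nneg_i : nneg (vec i *m rho (v k)).
  apply: IHm => //; move: next_ge prev_ge; rewrite vS [v k.-1]v_prev prednK //.
  by case: (k) k_gt0 => // k' _ /=; case: odd.
have nneg_j : nneg (vec j *m rho (v k)).
  apply: IHm => //; move: next_ge prev_ge; rewrite vS [v k.-1]v_prev prednK //.
  by case: (k) k_gt0 => // k' _ /=; case: odd.
have gij : - gram i j = cos2 R #[e j * e i]%g.
  by rewrite mxE (negPf neq_ij) opprK order_mulgC.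
have o_gt1 : (1 < #[e j * e i]%g)%N by rewrite order_gen_gt1 // eq_sym.
rewrite (wE k) rhoM ?altw_mem // mulmxA vec_altw // gij.
have le_km := ltnW k_lt.
by case: odd; rewrite mulmxDl -!scalemxAl nneg_comb ?chebU_cos2_ge0.
Qed.


Implicit Types (x y z : 'rV[R]_n).

Lemma nneg_anti x : nneg x -> nneg (- x) -> x = 0.
Proof.
move=> /nnegP x_ge0 /nnegP x_le0; apply/rowP=> j; rewrite mxE; apply/eqP.
by rewrite eq_le x_ge0 andbT; have := x_le0 j; rewrite mxE oppr_ge0.
Qed.

Lemma vec_neq0 i : vec i != 0.
Proof.
apply/negP=> /eqP/rowP/(_ i); rewrite !mxE !eqxx => /eqP.
by rewrite oner_eq0.
Qed.

(** * Positive and negative roots *)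

Definition root x := exists i, exists2 w, w \in W & x = vec i *m rho w.

Lemma root_vec i : root (vec i).
Proof. by exists i, 1%g; rewrite ?rho1 ?mulmx1. Qed.

Lemma root_mul x w : w \in W -> root x -> root (x *m rho w).
Proof.
move=> Ww [i [u Wu ->]]; exists i, (u * w)%g; rewrite ?groupM //.
by rewrite rhoM ?mulmxA.
Qed.

Lemma vec_gen_mul i w : w \in W -> vec i *m rho (e i * w)%g = - (vec i *m rho w).
Proof.
move=> Ww; rewrite rho_genM // mulmxA vec_srefl gram_id scaler_nat mulr2n.
by rewrite opprD addNKr mulNmx.
Qed.

Lemma root_opp x : root x -> root (- x).
Proof.
move=> [i [w Ww ->]]; exists i, (e i * w)%g; rewrite ?groupM //.
by rewrite vec_gen_mul.
Qed.

Lemma mulmx_rho_eq0 x w : w \in W -> x *m rho w = 0 -> x = 0.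
Proof. by move=> Ww xw; rewrite -[x]mulmx1 -(rhoVr Ww) mulmxA xw mul0mx. Qed.

Lemma root_neq0 x : root x -> x != 0.
Proof.
move=> [i [w Ww ->]]; apply/negP=> /eqP/(mulmx_rho_eq0 Ww)/eqP.
by rewrite (negPf (vec_neq0 i)).
Qed.

Lemma root_sign x : root x -> nneg x \/ nneg (- x).
Proof.
move=> [i [w Ww ->]]; have [lt_w|] := boolP (len (e i * w)%g < len w)%N.
  right; rewrite -vec_gen_mul // root_nneg ?groupM // gen_mulK.
  by rewrite -leqNgt ltnW.
by left; apply: root_nneg.
Qed.

Lemma root_nnegN x : root x -> nneg (- x) = ~~ nneg x.
Proof.
move=> x_root; apply/idP/idP=> [x_le0|].
  by apply: contra (root_neq0 x_root) => x_ge0; apply/eqP/nneg_anti.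
by case: (root_sign x_root) => [->|->].
Qed.

(** An element other than 1 has a descent [j], and then it sends [vec j] to a negative root. *)
Lemma rho_eq1 w : w \in W -> rho w = 1%:M -> w = 1%g.
Proof.
move=> Ww rw1; apply/eqP/negPn/negP=> /(descent Ww)[j lt_w].
have : nneg (- vec j).
  rewrite -[vec j]mulmx1 -rw1 -vec_gen_mul // root_nneg ?groupM // gen_mulK.
  by rewrite -leqNgt ltnW.
by rewrite root_nnegN ?nneg_vec //; apply: root_vec.
Qed.

Lemma rho_inj : {in W &, injective rho}.
Proof.
move=> x y Wx Wy eq_xy; apply/eqP; rewrite eq_mulgV1; apply/eqP/rho_eq1.
  by rewrite groupM ?groupV.
by rewrite rhoM ?groupV // eq_xy rhoVr.
Qed.

(** * The invariant bilinear form *)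

Definition form (x y : 'rV[R]_n) : R := (x *m gram *m y^T) 0 0.

Lemma form_sum x y : form x y = \sum_j (x *m gram) 0 j * y 0 j.
Proof. by rewrite /form mxE; apply: eq_bigr => j _; rewrite [y^T _ _]mxE. Qed.

Lemma formDl x y z : form (x + y) z = form x z + form y z.
Proof. by rewrite /form !mulmxDl mxE. Qed.

Lemma formZl a x y : form (a *: x) y = a * form x y.
Proof. by rewrite /form -!scalemxAl mxE. Qed.

Lemma formC x y : form x y = form y x.
Proof.
rewrite /form -[x *m gram *m y^T]trmxK [in LHS]mxE trmx_mul trmx_mul.
by rewrite trmxK gram_tr mulmxA.
Qed.

Lemma formDr x y z : form z (x + y) = form z x + form z y.
Proof. by rewrite formC formDl !(formC z). Qed.

Lemma formZr a x y : form y (a *: x) = a * form y x.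
Proof. by rewrite formC formZl formC. Qed.

Lemma form_vec x i : form x (vec i) = (x *m gram) 0 i.
Proof.
rewrite form_sum (bigD1 i) //= big1 ?addr0 ?mxE ?eqxx ?mulr1 // => j.
by move=> neq_ji; rewrite [vec i _ _]mxE (negPf neq_ji) mulr0.
Qed.

Lemma form_vec2 i : form (vec i) (vec i) = 2.
Proof. by rewrite form_vec vec_gram gram_id. Qed.

Lemma mul_srefl_form x i : x *m srefl i = x - form x (vec i) *: vec i.
Proof. by rewrite mul_srefl form_vec. Qed.

Lemma form_rho x y w : w \in W -> form (x *m rho w) (y *m rho w) = form x y.
Proof.
move=> Ww; elim/gen_ind: w / Ww x y => [|i w Ww IHw] x y.
  by rewrite rho1 !mulmx1.
rewrite rho_genM // !mulmxA IHw !mul_srefl_form -!scaleNr.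
rewrite !(formDl, formDr, formZl, formZr) form_vec2 (formC (vec i) y).
by ring.
Qed.

Lemma root_form x : root x -> form x x = 2.
Proof. by move=> [i [w Ww ->]]; rewrite form_rho // form_vec2. Qed.

Lemma rho_reflection x i w : w \in W ->
  x *m rho (e i ^ w)%g = x - form x (vec i *m rho w) *: (vec i *m rho w).
Proof.
move=> Ww; rewrite conjgE !rhoM ?groupM ?groupV // !mulmxA rho_gen.
rewrite mul_srefl_form mulmxBl -mulmxA rhoVl // mulmx1 -scalemxAl.
by rewrite -(form_rho _ _ Ww) -mulmxA rhoVl ?mulmx1.
Qed.

(** Applying the two equal reflections to the root [y] shows that [y] is proportional to [x]; both
    have norm 2, so the factor is 1 or -1. *)
Lemma eq_reflection i j u w : u \in W -> w \in W ->
  (e i ^ u = e j ^ w)%g <->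
  vec j *m rho w = vec i *m rho u \/ vec j *m rho w = - (vec i *m rho u).
Proof.
move=> Wu Ww; set x := vec i *m rho u; set y := vec j *m rho w.
have formx : form x x = 2 by apply: root_form; exists i, u.
have formy : form y y = 2 by apply: root_form; exists j, w.
have mem_refl k v : v \in W -> (e k ^ v)%g \in W by move=> Wv; rewrite groupJ.
split=> [eq_uw|eq_xy]; last first.
  apply: rho_inj; rewrite ?mem_refl //.
  apply: mulmx_inj_row => z; rewrite !rho_reflection //.
  rewrite -/x -/y; case: eq_xy => -> //.
  by rewrite -[- x]scaleN1r formZr scalerA mulN1r mulrN1 opprK.
have /(congr1 (fun A => y *m A)) : rho (e i ^ u)%g = rho (e j ^ w)%g by rewrite eq_uw.
rewrite !rho_reflection // -/x -/y => /addrI/oppr_inj; rewrite formy.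
set l := form y x => eq_xy.
have def_y : y = (l / 2) *: x.
  by rewrite mulrC -scalerA eq_xy scalerA mulVf ?scale1r // pnatr_eq0.
have /eqP : (l / 2) ^+ 2 = 1.
  have two_neq0 : 2 != 0 :> R by rewrite pnatr_eq0.
  by apply: (mulIf two_neq0); rewrite mul1r -[RHS]formy def_y formZl formZr formx mulrA.
rewrite sqrf_eq1 => /orP[] /eqP l2; [left | right].
  by rewrite def_y l2 scale1r.
by rewrite def_y l2 scaleN1r.
Qed.

(** Left multiplication by [e i] permutes [W] and negates row [i] of the sum. *)
Lemma sum_rho : \sum_(w in W) rho w = 0.
Proof.
apply/row_matrixP=> i; rewrite rowE row0 mulmx_sumr.
have: \sum_(w in W) vec i *m rho w = - \sum_(w in W) vec i *m rho w.
  rewrite [LHS](reindex_inj (mulgI (e i))) /= -sumrN.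
  by apply: eq_big => [w|w Ww]; rewrite ?groupMl // vec_gen_mul // -(groupMl _ (gen_mem i)).
move/eqP; rewrite -subr_eq0 opprK -mulr2n -scaler_nat scaler_eq0 pnatr_eq0 /=.
by move/eqP.
Qed.

(** A vector in the radical is fixed by all of [W], so its multiple by the order of [W] is its image
    under the vanishing sum [sum_rho]. *)
Lemma gram_inj x : x *m gram = 0 -> x = 0.
Proof.
move=> xG0.
have fix_x w : w \in W -> x *m rho w = x.
  move=> Ww; elim/gen_ind: w / Ww => [|i w Ww IHw]; first by rewrite rho1 mulmx1.
  by rewrite rho_genM // mulmxA mul_srefl xG0 mxE scale0r subr0.
have: x *m (\sum_(w in W) rho w) = 0 by rewrite sum_rho mulmx0.
rewrite mulmx_sumr (eq_bigr (fun=> x)) // sumr_const => /eqP.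
rewrite -scaler_nat scaler_eq0 pnatr_eq0 -leqn0 leqNgt cardG_gt0 /=.
by move/eqP.
Qed.

(** * Products of simple reflections and their fixed vectors *)

Definition prodw (t : seq 'I_n) := (\prod_(i <- t) e i)%g.

Lemma prodw_cons i t : prodw (i :: t) = (e i * prodw t)%g.
Proof. exact: big_cons. Qed.

Lemma prodw_mem t : prodw t \in W.
Proof. by apply: group_prod. Qed.

Lemma prodw_coord t x j : j \notin t -> (x *m rho (prodw t)) 0 j = x 0 j.
Proof.
elim: t x => [|i t IHt] x; first by rewrite /prodw big_nil rho1 mulmx1.
rewrite inE negb_or => /andP[neq_ji not_tj].
rewrite prodw_cons rho_genM ?prodw_mem // mulmxA IHt // mul_srefl !mxE.
by rewrite (negPf neq_ji) mulr0 subr0.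
Qed.

(** As the letters are distinct, only the first one changes its own coordinate. If the product fixes
    [x], then so does this letter, and the rest of the word is treated by induction. *)
Lemma prodw_fix t x : uniq t -> x *m rho (prodw t) = x ->
  {in t, forall i, (x *m gram) 0 i = 0}.
Proof.
elim: t => // i t IHt /= /andP[not_ti uniq_t].
rewrite prodw_cons rho_genM ?prodw_mem // mulmxA mul_srefl => fix_x.
have g0 : (x *m gram) 0 i = 0.
  move: (_ 0 i) fix_x => g /rowP/(_ i); rewrite prodw_coord // !mxE !eqxx mulr1.
  by move/eqP; rewrite -subr_eq0 addrAC subrr add0r oppr_eq0 => /eqP.
rewrite g0 scale0r subr0 in fix_x.
by move=> j; rewrite inE => /predU1P[->//|]; apply: IHt.
Qed.

Lemma prodw_fix0 t x : uniq t -> (forall i, i \in t) -> x *m rho (prodw t) = x ->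
  x = 0.
Proof.
move=> uniq_t all_t fix_x; apply: gram_inj; apply/rowP=> i.
by rewrite (prodw_fix uniq_t fix_x) ?mxE.
Qed.

Lemma gram_off i j : i != j -> gram i j = - cos2 R #[e i * e j]%g.
Proof. by move=> neq_ij; rewrite mxE (negPf neq_ij). Qed.

Lemma gram_le0 i j : i != j -> gram i j <= 0.
Proof.
move=> neq_ij; have [c_ge0 _ _ _] := cos2P R (order_gen_gt1 S_order2 neq_ij).
by rewrite gram_off // oppr_le0.
Qed.

Lemma gram_neq0 i j : i != j -> (gram i j != 0) = (2 < #[e i * e j]%g)%N.
Proof.
move=> neq_ij; rewrite gram_off // oppr_eq0.
have := order_gen_gt1 S_order2 neq_ij.
rewrite leq_eqVlt => /predU1P[<-|m_gt2]; first by rewrite cos2_2 eqxx.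
by rewrite m_gt2 gt_eqF // (lt_le_trans ltr01) ?cos2_ge1 // ltnW.
Qed.

Lemma gram_leN1 i j : i != j -> gram i j != 0 -> gram i j <= -1.
Proof.
move=> neq_ij; rewrite gram_neq0 // gram_off // lerN2 => m_gt2.
by rewrite cos2_ge1 // ltnW.
Qed.

Lemma gram0_commute i j : i != j -> gram i j = 0 -> commute (e i) (e j).
Proof.
move=> neq_ij /eqP; rewrite -[_ == _]negbK gram_neq0 // -leqNgt => m_le2.
have m2 : #[e i * e j]%g = 2%N.
  by apply/eqP; rewrite eqn_leq m_le2 (order_gen_gt1 S_order2).
apply/eqP; rewrite /commute eq_mulgV1 invMg !(gen_inv S_order2).
by rewrite -expg2 -m2 expg_order.
Qed.

(** Induction on length: a descent [j] of [w] adds a nonnegative multiple of the positive root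
    [vec j *m rho (e j * w)]. *)
Lemma antidominant_nneg v w : (forall i, (v *m gram) 0 i <= 0) -> w \in W ->
  nneg (v *m rho w - v).
Proof.
move=> v_le0; have [m] := ubnP (len w); elim: m w => // m IHm w lt_wm Ww.
have [->|neq_w1] := eqVneq w 1%g.
  by rewrite rho1 mulmx1 subrr; apply/nnegP=> j; rewrite mxE.
have [j lt_jw] := descent Ww neq_w1.
have Wjw : (e j * w)%g \in W by rewrite groupM.
rewrite -(gen_mulK j w) rho_genM // mulmxA mul_srefl mulmxBl -scalemxAl.
rewrite -addrAC -[_ *m _ - v]scale1r -scaleNr nneg_comb ?ler01 //.
- by rewrite oppr_ge0.
- by apply: IHm => //; apply: leq_trans lt_jw _.
by apply: root_nneg => //; rewrite gen_mulK -leqNgt ltnW.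
Qed.

(* Otherwise the sum v of the simple roots in J is antidominant, so v rho(w) >= v
   for all w, whereas the sum of v rho(w) over w in W vanishes. *)
Lemma leaf_ex (J : {set 'I_n}) : J != set0 -> exists2 i, i \in J &
  (#|[set j in J | (j != i) && (gram i j != 0)%R]| <= 1)%N.
Proof.
move=> J_neq0; apply/exists_inP; apply: contraNT J_neq0.
rewrite negb_exists_in => /forall_inP deg2.
pose v : 'rV[R]_n := \sum_(j in J) vec j.
have vG i : (v *m gram) 0 i = \sum_(j in J) gram j i.
  by rewrite mulmx_suml summxE; apply: eq_bigr => j _; rewrite vec_gram.
have v_le0 i : (v *m gram) 0 i <= 0.
  rewrite vG; have [Ji|notJi] := boolP (i \in J); last first.
    by apply: sumr_le0 => j Jj; apply: gram_le0; apply: contraNneq notJi => <-.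
  rewrite (bigD1 i) //= gram_id.
  rewrite (bigID (fun j => gram i j != 0)) /= [X in _ + (_ + X)]big1 ?addr0; last first.
    by move=> j /andP[_ /negPn/eqP]; rewrite gramC.
  rewrite addrC -subr_ge0 sub0r opprD -subr_ge0.
  pose N := [set j in J | (j != i) && (gram i j != 0)].
  (* Each neighbour contributes at most -1, so two of them outweigh the diagonal entry 2. *)
  have leN : \sum_(j in N) gram j i <= \sum_(j in N) -1.
    apply: ler_sum => j; rewrite inE => /and3P[_ neq_ji gij].
    by rewrite gram_leN1 // gramC.
  rewrite (eq_bigl (mem N)); last by move=> j; rewrite !inE andbA.
  have := deg2 i Ji; rewrite -/N -ltnNge => N_ge2.
  have : (2 : R) <= #|N|%:R by rewrite ler_nat.
  move: leN; rewrite sumr_const mulNrn; lra.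
have sum0 : \sum_(w in W) (v *m rho w - v) = - (v *+ #|W|).
  by rewrite sumrB -mulmx_sumr sum_rho mulmx0 sumr_const sub0r.
apply/eqP/setP=> i; rewrite inE; apply/negP=> Ji.
have: 0 <= (\sum_(w in W) (v *m rho w - v)) 0 i.
  by rewrite summxE sumr_ge0 // => w Ww; apply/nnegP/antidominant_nneg.
rewrite sum0 mxE oppr_ge0 leNgt => /negP[].
have vi : v 0 i = 1.
  rewrite summxE (bigD1 i) //= big1 ?addr0; first by rewrite mxE !eqxx.
  by move=> j /andP[_ neq_ji]; rewrite mxE eq_sym (negPf neq_ji).
by rewrite mulmxnE vi ltr0n cardG_gt0.
Qed.

Lemma root_simple x i : root x -> nneg x -> (forall j, j != i -> x 0 j = 0) ->
  x = vec i.
Proof.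
move=> x_root /nnegP x_ge0 x0.
have def_x : x = x 0 i *: vec i.
  apply/rowP=> j; rewrite !mxE eqxx /=.
  by have [->|/x0->] := eqVneq j i; rewrite ?mulr1 ?mulr0.
have := root_form x_root; rewrite def_x formZl formZr form_vec2 mulrA => formx.
have /eqP : x 0 i ^+ 2 = 1.
  have two_neq0 : 2 != 0 :> R by rewrite pnatr_eq0.
  by apply: (mulIf two_neq0); rewrite mul1r.
rewrite sqrf_eq1 => /orP[] /eqP xi; first by rewrite xi scale1r.
by have := x_ge0 i; rewrite xi oppr_ge0 ler10.
Qed.

(** A simple reflection changes a single coordinate, so a positive root that it makes negative has
    no other nonzero coordinate. *)
Lemma root_srefl_sign x i : root x -> nneg x -> ~~ nneg (x *m srefl i) -> x = vec i.
Proof.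
move=> x_root x_ge0; have xs_root : root (x *m srefl i).
  by rewrite -rho_gen; apply: root_mul.
rewrite -root_nnegN // => /nnegP xs_le0; apply: root_simple => // j neq_ji.
have := xs_le0 j; rewrite mul_srefl !mxE eqxx /= (negPf neq_ji) mulr0 subr0.
by rewrite oppr_ge0 => x_le0; apply/eqP; rewrite eq_le x_le0; apply/nnegP.
Qed.

(** * Roots of parabolic subgroups *)

Lemma parabolic_sub (J : {set 'I_n}) : <<[set e i | i in J]>>%g \subset W.
Proof.
by rewrite genS //; apply/subsetP=> _ /imsetP[i _ ->]; apply: enum_valP.
Qed.

Lemma parabolic_coord (J : {set 'I_n}) x w j : w \in <<[set e i | i in J]>>%g ->
  j \notin J -> (x *m rho w) 0 j = x 0 j.
Proof.
move=> WJw notJj; have [t [_ + <-]] := abs_lengthP WJw.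
elim: t x => [|s t IHt] x /=; first by rewrite big_nil rho1 mulmx1.
case/andP=> /imsetP[i Ji ->] Jt; rewrite big_cons rho_genM; last first.
  by rewrite (subsetP (parabolic_sub J)) ?prod_mem_gen.
rewrite mulmxA IHt // mul_srefl !mxE (_ : (j == i) = false) ?andbF ?mulr0 ?subr0 //.
by apply: contraNF notJj => /eqP->.
Qed.

(** Take the positive root [y] of least height in the orbit of [x] under [WJ]. As [form y y] is 2,
    some [j] has positive coordinate and positive pairing with [y]; reflecting in [j] lowers the
    height, hence makes [y] negative, so [y] is [vec j]. *)
Lemma root_support (J : {set 'I_n}) x : root x -> (forall j, j \notin J -> x 0 j = 0) ->
  exists2 j, j \in J & exists2 w, w \in <<[set e i | i in J]>>%g & x = vec j *m rho w.
Proof.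
set WJ := <<_>>%g => x_root xJ.
have WJgen i : i \in J -> e i \in WJ by move=> Ji; rewrite mem_gen ?imset_f.
wlog x_ge0 : x x_root xJ / nneg x.
  move=> IHx; have [|x_le0] := root_sign x_root; first exact: IHx.
  have [|j Jj [w WJw def_x]] := IHx (- x) (root_opp x_root) _ x_le0.
    by move=> j /xJ xj0; rewrite mxE xj0 oppr0.
  exists j => //; exists (e j * w)%g; first by rewrite groupM ?WJgen.
  by rewrite vec_gen_mul ?(subsetP (parabolic_sub J)) // -def_x opprK.
pose P (w : gT) := (w \in WJ) && nneg (x *m rho w).
pose ht (w : gT) := \sum_j (x *m rho w) 0 j.
have P1 : P 1%g by rewrite /P group1 rho1 mulmx1.
case: (@Order.TotalTheory.arg_minP _ _ _ 1%g P ht P1) => w /andP[WJw xw_ge0] min_w.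
have Ww := subsetP (parabolic_sub J) _ WJw.
set y := x *m rho w in xw_ge0.
have y_root : root y by apply: root_mul.
have yJ j : j \notin J -> y 0 j = 0.
  by move=> notJj; rewrite (parabolic_coord _ WJw) ?xJ.
have [j yj] : exists j, 0 < (y *m gram) 0 j * y 0 j.
  apply/existsP; have := root_form y_root; rewrite form_sum => sum_y.
  rewrite -[[exists _, _]]negbK negb_exists; apply/negP=> /forallP y_le0.
  have : 2 <= 0 :> R by rewrite -sum_y; apply: sumr_le0 => j _; rewrite leNgt.
  by rewrite lern0.
have yj_ge0 : 0 <= y 0 j by apply/nnegP.
have yj_gt0 : 0 < y 0 j.
  by rewrite lt_neqAle yj_ge0 andbT; apply: contraTneq yj => <-; rewrite mulr0 ltxx.
have Jj : j \in J by apply: contraTT yj_gt0 => /yJ->; rewrite ltxx.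
have yGj : 0 < (y *m gram) 0 j by rewrite -(pmulr_lgt0 _ yj_gt0).
have def_y : y = vec j.
  apply: root_srefl_sign => //; apply: contraTN yGj => ys_ge0; rewrite -leNgt.
  have := min_w (w * e j)%g; rewrite /P groupM ?WJgen //= /ht rhoM // mulmxA.
  rewrite rho_gen ys_ge0 => /(_ isT); rewrite -/y mul_srefl.
  rewrite [X in _ <= X](eq_bigr (fun l => y 0 l - (y *m gram) 0 j * (l == j)%:R)).
    rewrite sumrB lerDl oppr_ge0 (bigD1 j) //= eqxx mulr1 big1 ?addr0 //.
    by move=> l /negPf->; rewrite mulr0.
  by move=> l _; move: ((y *m gram) 0 j) => g; rewrite !mxE eqxx.
exists j => //; exists w^-1%g; first by rewrite groupV.
by rewrite -def_y /y -mulmxA rhoVr // mulmx1.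
Qed.

(** * Reflections, their roots and moved spaces *)

Local Notation T := (reflections W S).

Lemma reflectionP t :
  reflect (exists i, exists2 w, w \in W & t = (e i ^ w)%g) (t \in T).
Proof.
apply: (iffP imset2P) => [[s w Ss Ww ->]|[i [w Ww ->]]].
  by exists (enum_rank_in Ss s), w; rewrite ?enum_rankK_in.
by exists (e i) w; rewrite ?enum_valP.
Qed.

(** One of the two opposite roots of the reflection [t], as picked; 0 if [t] is not a reflection. *)
Definition root_of (t : gT) : 'rV[R]_n :=
  if [pick p : 'I_n * gT | (p.2 \in W) && (t == e p.1 ^ p.2)%g] is Some p
  then vec p.1 *m rho p.2 else 0.

Lemma root_ofP t : t \in T ->
  exists i, exists w, [/\ w \in W, t = (e i ^ w)%g & root_of t = vec i *m rho w].
Proof.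
move/reflectionP=> [i [w Ww def_t]]; rewrite /root_of.
case: pickP => [[j u] /= /andP[Wu /eqP def_t']|/(_ (i, w))]; last first.
  by rewrite /= Ww def_t eqxx.
by exists j, u.
Qed.

(** Each letter displaces a vector by a multiple of its root, so the total displacement stays in the
    span of the roots. *)
Lemma sub_moved m (B : 'M[R]_(m, n)) ts : all (mem T) ts ->
    (forall t, t \in ts -> (root_of t <= B)%MS) ->
  (rho (\prod_(t <- ts) t)%g - 1%:M <= B)%MS.
Proof.
move=> Tts ts_B; apply/row_subP=> k; rewrite rowE mulmxBr mulmx1.
elim: ts Tts ts_B (vec k) => [|t ts IHts] /=.
  by move=> _ _ x; rewrite big_nil rho1 mulmx1 subrr sub0mx.
case/andP=> Tt Tts ts_B x; have [i [w [Ww def_t def_r]]] := root_ofP Tt.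
have W_ts : (\prod_(u <- ts) u)%g \in W.
  by rewrite -[W](gen_reflections S) prod_mem_gen.
rewrite big_cons rhoM //; last by rewrite def_t groupJ.
rewrite mulmxA; set y := x *m rho t; rewrite -(subrK y (_ *m _)) -addrA.
apply: addmx_sub; first by apply: IHts => // u ts_u; rewrite ts_B // inE ts_u orbT.
rewrite /y def_t rho_reflection // -def_r addrC addKr.
by rewrite eqmx_opp scalemx_sub // ts_B ?mem_head.
Qed.

(** By [prodw_fix] the fixed vectors are orthogonal to the simple roots in [s]; these are [size s]
    independent conditions, since [gram] is invertible and [P] selects the columns in [s]. *)
Lemma rank_prodw s : uniq s -> (size s <= \rank (rho (prodw s) - 1%:M)%R)%N.
Proof.
move=> uniq_s; pose P : 'M[R]_(n, size s) := \matrix_(i, l) (i == tnth (in_tuple s) l)%:R.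
have /tuple_uniqP inj_s : uniq (in_tuple s) by [].
have PTP : P^T *m P = 1%:M.
  apply/matrixP=> k l; rewrite !mxE (bigD1 (tnth (in_tuple s) k)) //= big1 ?addr0.
    rewrite !mxE eqxx mul1r; congr _%:R.
    by rewrite (inj_eq inj_s).
  by move=> i /negPf neq_ik; rewrite !mxE neq_ik mul0r.
have rankP : \rank P = size s.
  rewrite -mxrank_tr; apply/eqP; rewrite -/(row_free _); apply/row_freeP.
  by exists P.
have gram_full : row_full gram.
  rewrite row_full_unit -row_free_unit; apply: inj_row_free => x.
  exact: gram_inj.
have rankGP : \rank (gram *m P) = size s by rewrite (eqmxMfull _ gram_full).
set A := _ - _; have kerA : (kermx A <= kermx (gram *m P))%MS.
  apply/row_subP=> k; apply/sub_kermxP; set x := row k _.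
  have fix_x : x *m rho (prodw s) = x.
    apply/eqP; rewrite -subr_eq0 -[X in _ - X]mulmx1 -mulmxBr -/A.
    by apply/eqP/sub_kermxP/row_sub.
  rewrite mulmxA; apply/rowP=> l; rewrite !mxE big1 // => i _; rewrite [P _ _]mxE.
  case: eqP => [->|_]; last by rewrite mulr0.
  by rewrite (prodw_fix uniq_s fix_x) ?mem_tnth ?mul0r.
have := mxrankS kerA; rewrite !mxrank_ker rankGP.
have := rank_leq_row (gram *m P); have := rank_leq_row A; rewrite rankGP; lia.
Qed.

(** The moved space has dimension at least [size s] and is spanned by [size ts] roots. *)
Lemma size_refl_word s ts : uniq s -> all (mem T) ts ->
  (\prod_(t <- ts) t = prodw s)%g -> (size s <= size ts)%N.
Proof.
move=> uniq_s Tts def_s; apply: leq_trans (rank_prodw uniq_s) _.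
pose B : 'M[R]_(size ts, n) := \matrix_(l < size ts) root_of (nth 1%g ts l).
apply: leq_trans (rank_leq_row B); apply: mxrankS; rewrite -def_s.
apply: sub_moved => // t /(nthP 1%g)[l lt_l <-].
by have := row_sub (Ordinal lt_l) B; rewrite rowK.
Qed.

(* The roots of a reflection word of minimal length span the moved space of its
   product, here the span of the simple roots in s. *)
Lemma refl_word_parabolic s ts (J := [set e i | i in s]) : uniq s ->
    all (mem T) ts -> (\prod_(t <- ts) t = prodw s)%g -> size ts = size s ->
  all (mem (reflections <<J>>%g J)) ts.
Proof.
move=> uniq_s Tts def_s szts; set I := [set i in s].
have defJ : J = [set e i | i in I].
  by apply/setP=> t; apply/imsetP/imsetP=> -[i si ->]; exists i; rewrite ?inE // inE in si *.
pose B : 'M[R]_(size ts, n) := \matrix_(l < size ts) root_of (nth 1%g ts l).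
have ts_B t : t \in ts -> (root_of t <= B)%MS.
  by move=> /(nthP 1%g)[l lt_l <-]; have := row_sub (Ordinal lt_l) B; rewrite rowK.
have sAB := sub_moved Tts ts_B; rewrite def_s in sAB.
have sBA : (B <= rho (prodw s) - 1%:M)%MS.
  rewrite -(geq_leqif (mxrank_leqif_sup sAB)).
  by apply: leq_trans (rank_leq_row _) _; rewrite szts rank_prodw.
apply/allP=> t ts_t; have Tt := allP Tts t ts_t.
have [i [w [Ww def_t def_r]]] := root_ofP Tt.
have [||j Ij [u WJu eq_r]] := @root_support I (root_of t).
- by rewrite def_r; exists i, w.
(* The root lies in the moved space of [prodw s], whose vectors have no coordinates outside [s]. *)
- move=> j; rewrite inE => notsj.
  have /submxP[x ->] := submx_trans (ts_B t ts_t) sBA.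
  by rewrite mulmxBr mulmx1 mxE prodw_coord // [X in _ + X]mxE subrr.
have Wu := subsetP (parabolic_sub I) _ WJu.
have -> : t = (e j ^ u)%g.
  by rewrite def_t; apply/(eq_reflection _ _ Ww Wu); left; rewrite -def_r.
by apply/imset2P; exists (e j) u; rewrite // defJ ?imset_f.
Qed.

Lemma one_notin_reflections : 1%g \notin T.
Proof.
apply/reflectionP=> -[i [w _ /esym/eqP]]; rewrite conjg_eq1 => /eqP ei1.
by have := gen_order S_order2 i; rewrite ei1 order1.
Qed.

Lemma gram_eq0 i j : i != j -> (gram i j == 0) = (e i * e j == e j * e i)%g.
Proof.
move=> neq_ij; apply/eqP/eqP=> [/(gram0_commute neq_ij)//|comm_ij].
apply/eqP; rewrite -[_ == _]negbK gram_neq0 // -leqNgt dvdn_leq // order_dvdn.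
by rewrite expgS expg1 {2}comm_ij mulgA -[X in (X * _)%g]mulgA gen_sqr mulg1 gen_sqr.
Qed.

(** * Coxeter elements of parabolic subgroups *)

Lemma coxeter_leaf (I : {set gT}) : I \subset S -> I != set0 ->
  exists2 s, s \in I & exists a, {in I, forall x : gT, x != s -> x != a -> commute s x}.
Proof.
move=> sIS /set0Pn[s0 Is0]; pose J := [set i | e i \in I].
have [|i] := @leaf_ex J.
  apply/set0Pn; exists (enum_rank_in (subsetP sIS _ Is0) s0).
  by rewrite inE enum_rankK_in ?(subsetP sIS).
rewrite inE => Ii; set N := [set j in J | _] => le_N1; exists (e i) => //.
have [a Na] : exists a, {in N, forall j, j = a}.
  have [N0|[a Na]] := set_0Vmem N; first by exists i => j; rewrite N0 inE.
  exists a => j Nj; apply/eqP/idPn=> neq_ja.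
  suff: (1 < #|N|)%N by rewrite ltnNge le_N1.
  by apply/card_gt1P; exists j, a.
exists (e a) => x Ix neq_xi neq_xa; have Sx := subsetP sIS x Ix.
pose j := enum_rank_in Sx x; have def_x : x = e j by rewrite enum_rankK_in.
rewrite def_x in Ix neq_xi neq_xa *; have neq_ji : j != i by apply: contraNneq neq_xi => ->.
apply: gram0_commute; first by rewrite eq_sym.
apply/eqP; apply: contraNT neq_xa => gij; apply/eqP; congr enum_val.
by apply: Na; rewrite !inE Ix neq_ji.
Qed.

Lemma index_word (p : seq gT) : {subset p <= S} -> exists s, p = [seq e i | i <- s].
Proof.
elim: p => [|x p IHp] pS; first by exists [::].
have Sx : x \in S by apply: pS; apply: mem_head.
have [|s ->] := IHp; first by move=> y py; apply: pS; rewrite inE py orbT.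
by exists (enum_rank_in Sx x :: s); rewrite /= enum_rankK_in.
Qed.

Lemma coxeter_element_prodw (J : {set gT}) c : J \subset S -> coxeter_element J c ->
  exists s, [/\ uniq s, c = prodw s, J = [set e i | i in s] & size s = #|J|].
Proof.
move=> sJS [p pJ ->].
have [|s def_p] := @index_word p.
  by move=> x; rewrite (perm_mem pJ) mem_enum; apply: (subsetP sJS).
exists s; split.
- by apply: (@map_uniq _ _ (fun i : 'I_n => e i)); rewrite -def_p (perm_uniq pJ) enum_uniq.
- by rewrite def_p big_map.
- apply/setP=> x; rewrite -[x \in J]mem_enum -(perm_mem pJ) def_p.
  by apply/mapP/imsetP.
by rewrite -(size_map (fun i : 'I_n => e i)) -def_p (perm_size pJ) -cardE.
Qed.

Lemma parabolic_refl_sub (J : {set gT}) : J \subset S -> reflections <<J>>%g J \subset T.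
Proof. by move=> sJS; apply: imset2S; rewrite ?genS. Qed.

Lemma parabolic_nfact (J : {set gT}) c j : J \subset S -> coxeter_element J c ->
  sumn j = #|J| -> nfact T j c = nfact (reflections <<J>>%g J) j c.
Proof.
move=> sJS cJ sumj; have [s [uniq_s def_c defJ szs]] := coxeter_element_prodw sJS cJ.
apply: nfact_restrict; first exact: parabolic_refl_sub.
move=> t Tt def_t; rewrite sumj -szs defJ; rewrite def_c in def_t.
split=> [|szt]; first exact: size_refl_word def_t.
exact: refl_word_parabolic.
Qed.

Lemma coxeter_length (J : {set gT}) c : J \subset S -> coxeter_element J c ->
  abs_length (reflections <<J>>%g J) c = #|J|.
Proof.
move=> sJS cJ; have [s [uniq_s def_c defJ szs]] := coxeter_element_prodw sJS cJ.
have Jc : c \in <<J>>%g.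
  by case: cJ => p pJ ->; apply: prod_mem_gen; apply/allP=> x; rewrite (perm_mem pJ) mem_enum.
apply/eqP; rewrite eqn_leq; apply/andP; split.
  case: cJ => p pJ ->; rewrite cardE -(perm_size pJ); apply: abs_length_le.
  apply/allP=> x; rewrite (perm_mem pJ) mem_enum /=.
  exact: (subsetP (sub_reflections J)).
have [|t [<- Tt def_t]] := @abs_lengthP _ (reflections <<J>>%g J) c.
  by rewrite gen_reflections.
rewrite -szs.
apply: size_refl_word; rewrite ?def_t //.
by apply: sub_all Tt => x; apply: (subsetP (parabolic_refl_sub sJS)).
Qed.

Lemma parabolic_multichains (J : {set gT}) c j : J \subset S -> coxeter_element J c ->
  sumn j = #|J| -> num_multichains <<J>>%g J c j = nfact T j c.
Proof.
move=> sJS cJ sumj; rewrite (parabolic_nfact sJS cJ) // num_multichainsE ?coxeter_length //.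
by case: cJ => p pJ ->; apply: prod_mem_gen; apply/allP=> x; rewrite (perm_mem pJ) mem_enum.
Qed.

Lemma coxeter_conj (J : {set gT}) c1 c2 : J \subset S ->
  coxeter_element J c1 -> coxeter_element J c2 -> exists2 g, g \in W & c2 = (c1 ^ g)%g.
Proof.
move=> sJS [p1 p1J ->] [p2 p2J ->].
have sub_p1 : {subset p1 <= S}.
  by move=> x; rewrite (perm_mem p1J) mem_enum; apply: (subsetP sJS).
have mv : cmove p1 p2.
  apply: (cmove_forest coxeter_leaf sub_p1).
    by rewrite (perm_uniq p1J) enum_uniq.
  by apply: perm_trans p1J _; rewrite perm_sym.
have [|g Wg ->] := @cmove_conj _ S _ _ mv; last by exists g.
by apply/allP=> x /sub_p1.
Qed.

(** * Orbits of the bipartite Coxeter element *)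

Variable col : 'I_n -> bool.
Hypothesis colP : forall i j, i != j -> col i = col j -> gram i j = 0.

Definition colour_class b := [seq i <- enum 'I_n | col i == b].
Definition half_cox b := prodw (colour_class b).
(** The weighted adjacency matrix of the Coxeter graph, with zero diagonal and entries 2 cos (pi /
    m). *)
Definition adj : 'M[R]_n := 2%:M - gram.

Lemma mem_colour_class b i : (i \in colour_class b) = (col i == b).
Proof. by rewrite mem_filter mem_enum andbT. Qed.

Lemma colour_class_uniq b : uniq (colour_class b).
Proof. by rewrite filter_uniq ?enum_uniq. Qed.

Lemma half_cox_mem b : half_cox b \in W. Proof. exact: prodw_mem. Qed.

Local Hint Resolve half_cox_mem : core.

Lemma prodw_mono b t x : uniq t -> {in t, forall i, col i = b} ->
  x *m rho (prodw t) = x - \sum_(i <- t) (x *m gram) 0 i *: vec i.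
Proof.
elim: t x => [|i t IHt] x /=.
  by rewrite /prodw !big_nil rho1 mulmx1 subr0.
case/andP=> not_ti uniq_t tb; have colt : {in t, forall j, col j = b}.
  by move=> j tj; apply: tb; rewrite inE tj orbT.
rewrite prodw_cons rho_genM ?prodw_mem // mulmxA IHt // mul_srefl big_cons opprD addrA.
congr (_ - _); apply: eq_big_seq => j tj; rewrite mulmxBl -scalemxAl; congr (_ *: _).
have neq_ij : i != j by apply: contraNneq not_ti => ->.
move: (vec_gram R i j); rewrite (colP neq_ij) ?(tb i) ?colt ?mem_head // => gij.
by move: (x *m gram) (vec i *m gram) gij => u v gij; rewrite !mxE gij mulr0 subr0.
Qed.

Lemma mul_half_cox b x :
  x *m rho (half_cox b) = x - \sum_(i | col i == b) (x *m gram) 0 i *: vec i.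
Proof.
rewrite /half_cox (prodw_mono (b := b)) ?colour_class_uniq //; last first.
  by move=> i; rewrite mem_colour_class => /eqP.
by rewrite big_filter big_enum_cond /=; congr (_ - _); apply: eq_bigl.
Qed.

Lemma half_cox_coord b x j :
  (x *m rho (half_cox b)) 0 j = if col j == b then x 0 j - (x *m gram) 0 j else x 0 j.
Proof.
rewrite mul_half_cox; move: (x *m gram) => u; rewrite !mxE summxE.
case: ifP => [jb|njb].
  rewrite (bigD1 j) //= big1 ?addr0 => [|i /andP[_ neq_ij]].
    by rewrite !mxE !eqxx mulr1.
  by rewrite !mxE eq_sym (negPf neq_ij) mulr0.
rewrite big1 ?subr0 // => i ib; rewrite !mxE.
by have /negPf-> : j != i by [apply: contraFneq njb => ->]; rewrite andbF mulr0.
Qed.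

Lemma vec_half_cox_same i : vec i *m rho (half_cox (col i)) = - vec i.
Proof.
apply/rowP=> j; rewrite half_cox_coord vec_gram.
have [->|neq_ji] := eqVneq j i; first by rewrite eqxx gram_id !mxE !eqxx /=; ring.
have v0 : vec i 0 j = 0 by rewrite mxE (negPf neq_ji) andbF.
rewrite [RHS]mxE v0 oppr0; case: eqP => // eq_col.
by rewrite colP ?subr0 // eq_sym.
Qed.

Lemma adj_id i : adj i i = 0.
Proof. by rewrite /adj !mxE !eqxx mulr1n subrr. Qed.

Lemma adj_off i j : i != j -> adj i j = - gram i j.
Proof. by move=> neq_ij; rewrite /adj [LHS]mxE !mxE (negPf neq_ij) sub0r. Qed.

Lemma adj_ge0 i j : 0 <= adj i j.
Proof.
have [->|neq_ij] := eqVneq i j; first by rewrite adj_id.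
by rewrite adj_off // oppr_ge0 gram_le0.
Qed.

Lemma adj_col i j : adj i j != 0 -> col j = ~~ col i.
Proof.
have [->|neq_ij] := eqVneq i j; first by rewrite adj_id eqxx.
rewrite adj_off // oppr_eq0; apply: contraNeq => neq_col.
by apply/eqP/colP => //; case: (col i) neq_col; case: (col j).
Qed.

Lemma adj_tr : adj^T = adj.
Proof. by rewrite /adj linearB /= tr_scalar_mx gram_tr. Qed.

Lemma vec_half_cox_diff i : vec i *m rho (half_cox (~~ col i)) = vec i + vec i *m adj.
Proof.
apply/rowP=> j; rewrite half_cox_coord vec_gram [RHS]mxE -[in RHS]rowE [row _ _ _ _]mxE.
case: eqP => [eq_col|neq_col].
  by congr (_ + _); rewrite adj_off //; apply: contra_eqN eq_col => /eqP->; case: (col j).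
have [->|adj_ij] := eqVneq (adj i j) 0; first by rewrite addr0.
by case: neq_col; apply: adj_col.
Qed.

Lemma half_cox_gram b x j : col j = b ->
  (x *m rho (half_cox b) *m gram) 0 j = - (x *m gram) 0 j.
Proof.
move=> jb; rewrite mul_half_cox mulmxBl mulmx_suml.
have term i : ((x *m gram) 0 i *: vec i *m gram) 0 j = (x *m gram) 0 i * gram i j.
  by rewrite -scalemxAl [LHS]mxE vec_gram.
rewrite [LHS]mxE [X in _ + X]mxE summxE (bigD1 j) ?jb //= big1 ?addr0.
  by rewrite term gram_id; ring.
by move=> i /andP[/eqP ib neq_ij]; rewrite term colP ?mulr0 // ib.
Qed.

Lemma half_cox_sqr b : (half_cox b * half_cox b)%g = 1%g.
Proof.
apply: rho_eq1; first by rewrite groupM.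
apply: mulmx_inj_row => x; rewrite mulmx1 rhoM // mulmxA.
apply/rowP=> j; rewrite !half_cox_coord; case: eqP => // jb.
by rewrite half_cox_gram // opprK subrK.
Qed.

Lemma half_cox_inv b : (half_cox b)^-1%g = half_cox b.
Proof. by apply/eqP; rewrite eq_invg_mul half_cox_sqr. Qed.

Lemma half_coxK b x : x *m rho (half_cox b) *m rho (half_cox b) = x.
Proof. by rewrite -mulmxA -rhoM // half_cox_sqr rho1 mulmx1. Qed.

(* Row i is the root obtained from the simple root i by applying alternately
   the two colour classes, k times in all, starting with the other colour. *)
Fixpoint knit (k : nat) : 'M[R]_n :=
  if k is k'.+1 then
    if k' is k''.+1 then adj *m knit k' - knit k'' else 1%:M + adj
  else 1%:M.

Lemma knitSS k : knit k.+2 = adj *m knit k.+1 - knit k.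
Proof. by []. Qed.

Lemma knit_ind (P : nat -> 'M[R]_n -> Prop) : P 0%N 1%:M -> P 1%N (1%:M + adj) ->
    (forall k, P k (knit k) -> P k.+1 (knit k.+1) ->
       P k.+2 (adj *m knit k.+1 - knit k)) ->
  forall k, P k (knit k).
Proof.
move=> P0 P1 PSS k; suff: P k (knit k) /\ P k.+1 (knit k.+1) by case.
by elim: k => [|k [IH1 IH2]]; split=> //; rewrite knitSS; apply: PSS.
Qed.

Lemma knit_comm k : knit k *m adj = adj *m knit k.
Proof.
elim/knit_ind: (knit k) => {k} [||k IH1 IH2].
- by rewrite mulmx1 mul1mx.
- by rewrite (mulmxDl _ _ adj) (mulmxDr adj 1%:M) mulmx1 mul1mx.
by rewrite (mulmxBl _ _ adj) -mulmxA IH2 IH1 [RHS]mulmxBr.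
Qed.

Lemma knit_tr k : (knit k)^T = knit k.
Proof.
elim/knit_ind: (knit k) => {k} [||k IH1 IH2]; first exact: trmx1.
  by rewrite linearD /= trmx1 adj_tr.
by rewrite linearB /= trmx_mul IH2 IH1 adj_tr knit_comm.
Qed.

Definition knitw i k := altw (half_cox (~~ col i)) (half_cox (col i)) k.

Lemma knitw_mem i k : knitw i k \in W.
Proof. by rewrite /knitw groupM ?groupX ?groupM. Qed.

(** The half of the other colour adds to [vec i] its weighted neighbours. Those have the other
    colour, so the rest of the word is their own alternating word, while [vec i] is negated by the
    next half; this is the recursion of [knit]. *)
Lemma vec_knit i k : vec i *m knit k = vec i *m rho (knitw i k).
Proof.
suff eq2 k' : (forall j, vec j *m knit k' = vec j *m rho (knitw j k')) /\
    (forall j, vec j *m knit k'.+1 = vec j *m rho (knitw j k'.+1)).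
  by have [->] := eq2 k.
elim: k' => [|k' [IH1 IH2]]; split=> // j.
- by rewrite /knitw altw0 rho1.
- by rewrite /knitw altwSl altw0 mulg1 vec_half_cox_diff mulmxDr mulmx1.
rewrite knitSS mulmxBr mulmxA IH1 /knitw [altw _ _ k'.+2]altwSl.
rewrite rhoM //; last by rewrite groupM ?groupX ?groupM.
rewrite [RHS]mulmxA vec_half_cox_diff mulmxDl addrC; set u := altw (half_cox (col j)) _ _.
have -> : vec j *m rho u = - (vec j *m rho (knitw j k')).
  by rewrite /u altwSl rhoM ?(knitw_mem j) // mulmxA vec_half_cox_same mulNmx.
congr (_ + _); rewrite [vec j *m adj]row_sum_delta !mulmx_suml; apply: eq_bigr => l _.
rewrite -!scalemxAl IH2; have [->|adj_jl] := eqVneq ((vec j *m adj) 0 l) 0.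
  by rewrite !scale0r.
rewrite -rowE mxE in adj_jl; congr (_ *: (_ *m rho _)).
by rewrite /knitw (adj_col adj_jl) negbK.
Qed.

Lemma knit_root i k : root (vec i *m knit k).
Proof. by rewrite vec_knit; exists i, (knitw i k); rewrite ?knitw_mem. Qed.

Lemma knitE i k j : (vec i *m knit k) 0 j = knit k i j.
Proof. by rewrite -rowE mxE. Qed.

Lemma knitC k i j : knit k i j = knit k j i.
Proof. by rewrite -[in RHS]knit_tr mxE. Qed.

(* knit k is symmetric, commutes with adj and has sign-coherent rows, so adj
   has no nonzero entry between a nonnegative and a nonpositive row. *)
Lemma knit_sign_adj k i j : adj i j != 0 ->
  nneg (vec i *m knit k) -> nneg (vec j *m knit k).
Proof.
move=> adj_ij i_ge0; have := knit_root j k; set V := knit k in i_ge0 *.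
move=> /root_nnegN; case: (nneg (vec j *m V)) => //= /nnegP j_le0.
have Vj l : V j l <= 0 by have := j_le0 l; rewrite mxE knitE oppr_ge0.
have [l Vil] : exists l, V i l != 0.
  apply/existsP; rewrite -[[exists _, _]]negbK negb_exists; apply/negP=> /forallP V0.
  have /negP[] := root_neq0 (knit_root i k); apply/eqP/rowP=> l; rewrite knitE mxE.
  by apply/eqP; rewrite -[_ == _]negbK V0.
have Vil_gt0 : 0 < V i l.
  by rewrite lt_neqAle eq_sym Vil -knitE; apply/nnegP.
have l_ge0 : nneg (vec l *m V).
  have := root_nnegN (knit_root l k); case: (nneg (vec l *m V)) => //= /nnegP/(_ i).
  by rewrite mxE knitE knitC oppr_ge0 leNgt Vil_gt0.
have Vl a : 0 <= V l a by rewrite -knitE; apply/nnegP.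
have VA_gt0 : 0 < (V *m adj) l j.
  rewrite mxE (bigD1 i) //= ltr_wpDr //.
    by apply: sumr_ge0 => a _; rewrite mulr_ge0 // adj_ge0.
  by rewrite mulr_gt0 ?[V l i]knitC // lt_neqAle eq_sym adj_ij adj_ge0.
have := VA_gt0; rewrite knit_comm mxE ltNge => /negP[].
by apply: sumr_le0 => a _; rewrite mulr_ge0_le0 ?adj_ge0 // [V a j]knitC.
Qed.

Hypothesis conn : forall i j, connect [rel i j | adj i j != 0] i j.

Lemma knit_sign k i j : nneg (vec i *m knit k) = nneg (vec j *m knit k).
Proof.
suff imp i' j' : nneg (vec i' *m knit k) -> nneg (vec j' *m knit k).
  by apply/idP/idP; apply: imp.
have /connectP[p] := conn i' j'.
elim: p i' => [|a p IHp] i' /=; first by move=> _ ->.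
by case/andP=> adj_ia path_p def_j /(knit_sign_adj adj_ia); apply: IHp.
Qed.

(** The sum is fixed by the Coxeter element, which fixes only 0 by [prodw_fix0]. *)
Lemma orbit_sum t x : uniq t -> (forall i, i \in t) ->
  \sum_(k < #[prodw t]%g) x *m rho (prodw t ^+ k)%g = 0.
Proof.
move=> uniq_t all_t; set c := prodw t; apply: (prodw_fix0 uniq_t all_t).
have Wc : c \in W by apply: prodw_mem.
rewrite mulmx_suml; under eq_bigr do rewrite -mulmxA -rhoM ?groupX // -expgSr.
case: #[c]%g (expg_order c) (order_gt0 c) => // m cm _.
by rewrite big_ord_recr big_ord_recl /= cm expg0 addrC.
Qed.

(** If the whole orbit were nonnegative, its zero sum would force the root itself to vanish. *)
Lemma orbit_neg t x : uniq t -> (forall i, i \in t) -> root x ->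
  exists k, ~~ nneg (x *m rho (prodw t ^+ k)%g).
Proof.
move=> uniq_t all_t x_root; set c := prodw t.
have Wc : c \in W by apply: prodw_mem.
have [|all_ge0] := boolP [exists k : 'I_#[c]%g, ~~ nneg (x *m rho (c ^+ k)%g)].
  by case/existsP=> k neg_k; exists k.
have ge0 (k : 'I_#[c]%g) : nneg (x *m rho (c ^+ k)%g).
  by move: all_ge0; rewrite negb_exists => /forallP/(_ k)/negPn.
have := root_neq0 x_root; case/eqP; apply/rowP=> j; rewrite [RHS]mxE.
have /rowP/(_ j) := orbit_sum x uniq_t all_t; rewrite -/c summxE [RHS]mxE.
move/eqP; rewrite psumr_eq0; last by move=> k _; apply/nnegP.
move/allP/(_ (Ordinal (order_gt0 c)) (mem_index_enum _)) => /eqP.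
by rewrite expg0 rho1 mulmx1.
Qed.

Lemma half_cox_cat_prodw b : exists t,
  [/\ uniq t, forall i, i \in t & half_cox (~~ b) * half_cox b = prodw t]%g.
Proof.
exists (colour_class (~~ b) ++ colour_class b); split; last by rewrite /prodw big_cat.
  rewrite cat_uniq !colour_class_uniq andbT; apply/hasPn=> i.
  by rewrite !mem_colour_class => /eqP->; case: b.
by move=> i; rewrite mem_cat !mem_colour_class; case: (col i) b => [] [].
Qed.

Lemma knitw_double i k : knitw i k.*2 = ((half_cox (~~ col i) * half_cox (col i)) ^+ k)%g.
Proof. by rewrite /knitw /altw odd_double doubleK expg0 mulg1. Qed.

(** Only coordinates of colour [b] change, so the others vanish on [x]. Simple roots of one colour
    are orthogonal, so the single reflection in any [j] with positive coordinate already makes [x]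
    negative, and [root_srefl_sign] applies. *)
Lemma root_half_cox_sign b x : root x -> nneg x -> ~~ nneg (x *m rho (half_cox b)) ->
  exists2 j, col j = b & x = vec j.
Proof.
move=> x_root /nnegP x_ge0; rewrite -root_nnegN; last exact: root_mul.
move/nnegP=> xc_le0.
have x0 j : col j != b -> x 0 j = 0.
  move=> neq_jb; have := xc_le0 j; rewrite mxE half_cox_coord (negPf neq_jb) oppr_ge0 => xj.
  by apply/eqP; rewrite eq_le xj x_ge0.
have [j xj] : exists j, x 0 j != 0.
  apply/existsP; rewrite -[[exists _, _]]negbK negb_exists; apply/negP=> /forallP x00.
  have /negP[] := root_neq0 x_root; apply/eqP/rowP=> l; rewrite mxE.
  by apply/eqP; rewrite -[_ == _]negbK x00.
have jb : col j = b by apply: contraNeq xj => /x0->.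
exists j => //; apply: root_srefl_sign => //; first exact/nnegP.
apply/negP=> /nnegP/(_ j); rewrite mul_srefl.
have -> : (x *m gram) 0 j = 2 * x 0 j.
  rewrite mxE (bigD1 j) //= gram_id [x 0 j * 2]mulrC big1 ?addr0 // => l neq_lj.
  have [lb|/x0->] := eqVneq (col l) b; last by rewrite mul0r.
  by rewrite colP ?mulr0 // lb.
rewrite !mxE !eqxx mulr1 leNgt; case/negP.
have : 0 < x 0 j by rewrite lt_neqAle eq_sym xj x_ge0.
by lra.
Qed.

Lemma knitwS i k :
  knitw i k.+1 = (knitw i k * half_cox (if odd k then col i else ~~ col i))%g.
Proof. by rewrite /knitw altwSr; case: odd. Qed.

Lemma knit_transition k i : nneg (vec i *m knit k) -> ~~ nneg (vec i *m knit k.+1) ->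
  exists j, vec i *m knit k = vec j /\ vec i *m knit k.+1 = - vec j.
Proof.
move=> ge0; have x_root := knit_root i k; rewrite !vec_knit in ge0 x_root *.
rewrite knitwS rhoM ?knitw_mem // mulmxA => lt0.
have [j <- eq_j] := root_half_cox_sign x_root ge0 lt0.
by exists j; rewrite eq_j vec_half_cox_same.
Qed.

(* At the first sign change, knit is a symmetric permutation matrix P, so that
   P ^ 2 = 1; the recursion then reproduces -P knit k after L steps. *)
Lemma half_turn (i0 : 'I_n) : exists L, [/\ (0 < L)%N,
  forall k i, (k < L)%N -> nneg (vec i *m knit k),
  forall k i, (L <= k < L.*2)%N -> ~~ nneg (vec i *m knit k) & knit L.*2 = 1%:M].
Proof.
have ex_neg : exists k, ~~ nneg (vec i0 *m knit k).
  have [t [uniq_t all_t def_t]] := half_cox_cat_prodw (col i0).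
  have [k neg_k] := orbit_neg uniq_t all_t (root_vec i0).
  by exists k.*2; rewrite vec_knit knitw_double def_t.
have [L neg_L minL] := ex_minnP ex_neg.
have pos_lt k i : (k < L)%N -> nneg (vec i *m knit k).
  rewrite (knit_sign k i i0) => lt_kL; apply: contraLR lt_kL => /minL.
  by rewrite -leqNgt.
case: L neg_L {minL} pos_lt => [|L] neg_L pos_lt.
  by rewrite mulmx1 nneg_vec in neg_L.
set P := knit L.
have P_perm i : exists j, vec i *m P = vec j /\ vec i *m knit L.+1 = - vec j.
  by apply: knit_transition; [apply: pos_lt | rewrite (knit_sign _ i i0)].
have knitL1 : knit L.+1 = - P.
  by apply/row_matrixP=> i; rewrite !rowE; have [j [Pi ->]] := P_perm i; rewrite mulmxN Pi.
have PP : P *m P = 1%:M.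
  apply/row_matrixP=> i; rewrite !rowE mulmxA mulmx1.
  have [j [Pi _]] := P_perm i; have [l [Pj _]] := P_perm j.
  (* Row [i] of [P] is [vec j]; by symmetry row [j] has entry 1 at [i], so it is [vec i]. *)
  have := knitC L i j; rewrite -!knitE -/P Pi Pj !mxE !eqxx /=.
  have [-> _|_ /eqP] := eqVneq i l; first by [].
  by rewrite oner_eq0.
have shift k : knit (L.+1 + k) = - (P *m knit k).
  suff: knit (L.+1 + k) = - (P *m knit k) /\ knit (L.+1 + k.+1) = - (P *m knit k.+1).
    by case.
  elim: k => [|k [IH1 IH2]].
    rewrite addn0 addn1 knitSS knitL1 mulmx1 mulmxDr mulmx1 mulmxN opprD addrC.
    by rewrite knit_comm.
  split=> //; rewrite !addnS knitSS -addnS IH1 IH2 knitSS.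
  by rewrite mulmxBr mulmxN opprB opprK addrC !mulmxA knit_comm.
exists L.+1; split=> // [k i /andP[le_Lk lt_k2L]|].
  rewrite -(subnKC le_Lk) shift mulmxN mulmxA.
  have [j [-> _]] := P_perm i; rewrite root_nnegN; last exact: knit_root.
  by rewrite negbK pos_lt // ltn_subLR // addnn.
by rewrite -addnn shift knitL1 mulmxN opprK.
Qed.

(** * The cyclic list of all roots *)

Definition bicox := (half_cox true * half_cox false)%g.

Lemma bicox_mem : bicox \in W. Proof. by rewrite groupM. Qed.

Lemma bicoxV : (bicox^-1 = half_cox false * half_cox true)%g.
Proof. by rewrite invMg !half_cox_inv. Qed.

Lemma half_turn_order L : (0 < L)%N -> knit L.*2 = 1%:M -> (#[bicox]%g <= L)%N.
Proof.
move=> L_gt0 knit2L; apply: dvdn_leq => //; rewrite order_dvdn; apply/eqP.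
apply: rho_eq1; first by rewrite groupX ?bicox_mem.
apply/row_matrixP=> i; rewrite !rowE mulmx1.
have := vec_knit i L.*2; rewrite knit2L mulmx1 knitw_double.
(* Rows of colour [true] are fixed by the power of [bicox^-1] instead, hence also by that of
   [bicox]. *)
case: (col i) => /= [|<-//]; rewrite -bicoxV expgVn => {1}->.
by rewrite -mulmxA rhoVl ?mulmx1 // groupX ?bicox_mem.
Qed.

(** [e i ^ shiftw i] is the prefix reflection of the letter [i] in [bicox]: letters of the second
    half are conjugated by the first half, while letters of the same half commute and have no
    effect. *)
Definition shiftw i := if col i then 1%g else half_cox true.
Definition cyc_root i k := vec i *m rho (shiftw i * bicox^-1 ^+ k)%g.

Lemma shiftw_mem i : shiftw i \in W.
Proof. by rewrite /shiftw; case: (col i); rewrite ?group1. Qed.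

Lemma bicoxVX_mem k : (bicox^-1 ^+ k \in W)%g.
Proof. by rewrite groupX ?groupV ?bicox_mem. Qed.

Local Hint Resolve shiftw_mem bicoxVX_mem bicox_mem : core.

Lemma cyc_root_knit i k : cyc_root i k = vec i *m knit (k.*2 + ~~ col i).
Proof.
rewrite vec_knit /cyc_root /knitw /shiftw; case col_i: (col i) => /=.
  by rewrite addn0 /altw odd_double doubleK expg0 mulg1 mul1g bicoxV.
congr (_ *m rho _); rewrite addn1 altwSl bicoxV.
by rewrite /altw odd_double doubleK expg0 mulg1.
Qed.

Lemma cyc_rootD i k l : cyc_root i (k + l) = cyc_root i k *m rho (bicox^-1 ^+ l)%g.
Proof. by rewrite /cyc_root expgD mulgA rhoM ?mulmxA // groupM. Qed.

Lemma cyc_root0 i : cyc_root i 0 = if col i then vec i else vec i *m rho (half_cox true).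
Proof. by rewrite /cyc_root mulg1 /shiftw; case: ifP; rewrite ?rho1 ?mulmx1. Qed.

Lemma knit_step i k :
  vec i *m knit k.+1 *m rho (half_cox (odd k == col i)) = vec i *m knit k.
Proof.
rewrite !vec_knit knitwS rhoM ?knitw_mem // mulmxA.
have -> : (if odd k then col i else ~~ col i) = (odd k == col i).
  by case: odd (col i) => [] [].
by rewrite half_coxK.
Qed.

Lemma vec_inj i j : vec i = vec j -> i = j.
Proof.
move/rowP/(_ j); rewrite !mxE !eqxx /=.
by have [->|_] := eqVneq i j => // /esym/eqP; rewrite oner_eq0.
Qed.

Lemma vec_oppN i j : vec i <> - vec j.
Proof.
by move=> eq_ij; have := root_nnegN (root_vec j); rewrite -eq_ij !nneg_vec.
Qed.

(* The rows equal to some cyc_root j 0 are preceded by a negative row within two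
   steps, so k > 0 would be a return to nonnegative rows before step 2 L. *)
Lemma cyc_root_eq0 i j k : (k < #[bicox]%g)%N -> cyc_root i k = cyc_root j 0 ->
  k = 0%N /\ i = j.
Proof.
have [L [L_gt0 pos_lt neg_ge knit2L]] := half_turn i.
have le_hL := half_turn_order L_gt0 knit2L.
case: k => [|k] lt_kh.
  rewrite !cyc_root0; case col_i: (col i); case col_j: (col j).
  - by move/vec_inj.
  - move/(congr1 (fun x => x *m rho (half_cox true))).
    rewrite half_coxK -{1}col_i vec_half_cox_same.
    by move/esym/vec_oppN.
  - move/(congr1 (fun x => x *m rho (half_cox true))).
    rewrite half_coxK -{1}col_j vec_half_cox_same.
    by move/vec_oppN.
  by move/(congr1 (fun x => x *m rho (half_cox true))); rewrite !half_coxK => /vec_inj.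
have lt_kL : (k.+1 < L)%N by apply: leq_trans le_hL.
rewrite cyc_root_knit doubleS addSn addSn; set m := (k.*2 + _)%N => def_x.
have odd_m : odd m = ~~ col i by rewrite oddD odd_double addFb; case: (col i).
have lt_m : (m.+2 < L.*2)%N.
  apply: leq_trans (_ : k.+2.*2 <= _)%N; last by rewrite leq_double.
  by rewrite !doubleS !ltnS -[X in (_ <= X)%N]addn1 leq_add2l; case: (~~ _).
(* Before step [L.*2] the rows never turn from negative to nonnegative. *)
have no_turn l : (l.+1 < L.*2)%N -> nneg (vec i *m knit l.+1) -> nneg (vec i *m knit l).
  move=> lt_l2L l1_ge0; apply: pos_lt; rewrite -ltnS ltnW // ltnS.
  by rewrite ltnNge; apply: contraL l1_ge0 => le_Ll; rewrite neg_ge ?le_Ll.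
have step2 := knit_step i m.+1; have step1 := knit_step i m.
rewrite oddS odd_m negbK eqxx def_x in step2.
have m_false : (~~ col i == col i) = false by case: (col i).
rewrite odd_m m_false in step1.
have notneg j' l : vec i *m knit l = - vec j' -> ~~ nneg (vec i *m knit l).
  by move=> ->; rewrite root_nnegN ?nneg_vec //; apply: root_vec.
rewrite cyc_root0 in def_x step2; case: ifP def_x step2 => col_j def_x step2.
  rewrite -{1}col_j vec_half_cox_same in step2.
  have /negP[] := notneg _ _ (esym step2); apply: no_turn => //.
  by rewrite def_x nneg_vec.
rewrite half_coxK in step2; rewrite -step2 -{1}col_j vec_half_cox_same in step1.
have /negP[] := notneg _ _ (esym step1); apply: no_turn; first exact: ltnW.
by rewrite -step2 nneg_vec.
Qed.

Lemma cyc_root_inj i j k l : (k < #[bicox]%g)%N -> (l < #[bicox]%g)%N ->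
  cyc_root i k = cyc_root j l -> i = j /\ k = l.
Proof.
wlog le_lk : i j k l / (l <= k)%N.
  move=> IHle lt_k lt_l eq_ij; case/orP: (leq_total l k) => [le_lk|le_kl].
    exact: IHle.
  by have [] := IHle j i l k le_kl lt_l lt_k (esym eq_ij).
move=> lt_k lt_l; rewrite -(subnK le_lk) -[l in RHS]add0n !cyc_rootD.
move/(congr1 (fun x => x *m rho (bicox^-1 ^+ l)^-1%g)).
rewrite -!mulmxA !rhoVr // !mulmx1 => /cyc_root_eq0[|sub0 ->].
  by apply: leq_ltn_trans lt_k; apply: leq_subr.
by rewrite sub0.
Qed.

Lemma bicox_prodw : exists t, [/\ uniq t, forall i, i \in t & bicox = prodw t]%g.
Proof. exact: (half_cox_cat_prodw false). Qed.

(** Some positive root in the orbit is made negative by one turn. The sign changes in one of the two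
    halves of [bicox], and [root_half_cox_sign] identifies the root there as a base root; turning
    back gives [x]. *)
Lemma cyc_root_surj x : root x -> exists i k, (k < #[bicox]%g)%N /\ x = cyc_root i k.
Proof.
move=> x_root; have [t [uniq_t all_t def_c]] := bicox_prodw.
have rootX z k : root z -> root (z *m rho (bicox ^+ k)%g).
  by apply: root_mul; rewrite groupX.
(* A negative member of the orbit of [- x] supplies a positive starting point in the orbit of
   [x]. *)
have [k0 k0_neg] : exists k, ~~ nneg (- x *m rho (bicox ^+ k)%g).
  by rewrite def_c; apply: orbit_neg => //; apply: root_opp.
have k0_pos : nneg (x *m rho (bicox ^+ k0)%g).
  by move: k0_neg; rewrite mulNmx root_nnegN ?negbK //; apply: rootX.
have [m m_neg] : exists k, ~~ nneg (x *m rho (bicox ^+ k0)%g *m rho (bicox ^+ k)%g).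
  by rewrite {2}def_c; apply: orbit_neg => //; apply: rootX.
have [k [k_pos k_neg]] : exists k, nneg (x *m rho (bicox ^+ k)%g) /\
    ~~ nneg (x *m rho (bicox ^+ k)%g *m rho bicox).
  elim: m m_neg => [|m IHm]; first by rewrite expg0 rho1 mulmx1 k0_pos.
  have [m_pos|/IHm//] := boolP (nneg (x *m rho (bicox ^+ k0)%g *m rho (bicox ^+ m)%g)).
  rewrite expgSr rhoM ?groupX // mulmxA => m1_neg; exists (k0 + m)%N.
  by rewrite expgD rhoM ?groupX // mulmxA.
have [j def_y] : exists j, x *m rho (bicox ^+ k)%g = cyc_root j 0.
  set y := x *m _ in k_pos k_neg *; have y_root : root y by apply: rootX.
  have [z_pos|z_neg] := boolP (nneg (y *m rho (half_cox true))); last first.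
    have [j col_j def_y] := root_half_cox_sign y_root k_pos z_neg.
    by exists j; rewrite cyc_root0 col_j.
  rewrite rhoM // mulmxA in k_neg.
  have [|j col_j def_z] := root_half_cox_sign _ z_pos k_neg; first exact: root_mul.
  by exists j; rewrite cyc_root0 col_j -def_z half_coxK.
exists j, (k %% #[bicox]%g)%N; split; first by rewrite ltn_mod order_gt0.
rewrite -[(k %% _)%N]add0n.
rewrite cyc_rootD -def_y expgVn expg_mod_order -mulmxA rhoVr ?mulmx1 //.
by rewrite groupX.
Qed.

Definition cyc_refl i k := (e i ^ (shiftw i * bicox^-1 ^+ k))%g.

(** The two positions are those of the two opposite roots of [t], each of which occurs exactly once
    in [cyc_root]. *)
Lemma card_cyc_refl t : t \in T ->
  #|[set p : 'I_n * 'I_#[bicox]%g | cyc_refl p.1 p.2 == t]| = 2%N.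
Proof.
case/reflectionP=> u [w Ww def_t].
have x_root : root (vec u *m rho w) by exists u, w.
have [i [k [lt_k def_x]]] := cyc_root_surj x_root.
have [j [l [lt_l def_xN]]] := cyc_root_surj (root_opp x_root).
have neq_p : (i, Ordinal lt_k) != (j, Ordinal lt_l).
  apply/eqP=> -[eq_ij eq_kl]; move: def_xN; rewrite -eq_ij -eq_kl -def_x.
  move/esym/eqP; rewrite -subr_eq0 opprK -mulr2n -scaler_nat scaler_eq0.
  by rewrite pnatr_eq0 (negPf (root_neq0 x_root)).
transitivity #|[set (i, Ordinal lt_k); (j, Ordinal lt_l)]|; last by rewrite cards2 neq_p.
have Wik a b : (shiftw a * bicox^-1 ^+ b)%g \in W by rewrite groupM.
apply: eq_card => -[a b]; rewrite !inE /cyc_refl def_t !xpair_eqE -!val_eqE /=.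
apply/eqP/orP=> [/esym/(eq_reflection _ _ Ww (Wik a b))|].
  rewrite -/(cyc_root a b) def_xN def_x => -[] /cyc_root_inj[] // eq_a eq_b.
    by left; rewrite eq_a eq_b !eqxx.
  by right; rewrite eq_a eq_b !eqxx.
by case=> /andP[/eqP/val_inj-> /eqP->]; apply/esym/(eq_reflection _ _ Ww (Wik _ _));
  rewrite -/(cyc_root _ _) -?def_x -?def_xN; [left | right].
Qed.

(** Double counting over pairs of an index and a turn: every reflection is met twice, and [f] does
    not depend on the turn. *)
Lemma bicox_count (f : gT -> nat) : {in T, forall t, f (t ^ bicox)%g = f t} ->
  (2 * \sum_(t in T) f t = #[bicox]%g * \sum_i f (e i ^ shiftw i)%g)%N.
Proof.
move=> fJ; have T_refl i k : cyc_refl i k \in T.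
  by apply/reflectionP; exists i, (shiftw i * bicox^-1 ^+ k)%g; rewrite ?groupM.
have f_refl i k : f (cyc_refl i k) = f (e i ^ shiftw i)%g.
  elim: k => [|k <-]; first by rewrite /cyc_refl mulg1.
  rewrite -fJ // /cyc_refl -conjgM expgSr -!mulgA mulVg mulg1.
  by [].
transitivity (\sum_(p : 'I_n * 'I_#[bicox]%g) f (cyc_refl p.1 p.2))%N; last first.
  rewrite -(pair_bigA _ (fun i (k : 'I_#[bicox]%g) => f (cyc_refl i k))) /= big_distrr /=.
  apply: eq_bigr => i _; under eq_bigr do rewrite f_refl.
  by rewrite sum_nat_const card_ord.
rewrite (partition_big (fun p : 'I_n * 'I_#[bicox]%g => cyc_refl p.1 p.2) (mem T)) //=.
rewrite big_distrr /=; apply: eq_bigr => t Tt.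
rewrite (eq_bigr (fun=> f t)) => [|p /eqP-> //].
by rewrite sum_nat_const -(card_cyc_refl Tt); congr (_ * _)%N; rewrite cardsE.
Qed.

(** * Deleting a letter, and the recursion *)

Definition gens b := [seq e i | i <- colour_class b].

Lemma half_cox_gens b : half_cox b = (\prod_(x <- gens b) x)%g.
Proof. by rewrite big_map. Qed.

Lemma mem_gens b i : (e i \in gens b) = (col i == b).
Proof. by rewrite mem_map ?mem_colour_class //; apply: enum_val_inj. Qed.

Lemma gens_sub b : {subset gens b <= S}.
Proof. by move=> _ /mapP[i _ ->]; apply: enum_valP. Qed.

Lemma gens_uniq b : uniq (gens b).
Proof. by rewrite map_inj_uniq ?colour_class_uniq //; apply: enum_val_inj. Qed.

Lemma gens_cat_uniq : uniq (gens true ++ gens false).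
Proof.
rewrite cat_uniq !gens_uniq andbT; apply/hasPn=> x /mapP[i].
by rewrite mem_colour_class => /eqP col_i ->; rewrite mem_gens col_i.
Qed.

Lemma bicox_coxeter : coxeter_element S bicox.
Proof.
exists (gens true ++ gens false); last by rewrite big_cat -!half_cox_gens.
apply: uniq_perm (enum_uniq _) _; first exact: gens_cat_uniq.
move=> x; rewrite mem_enum mem_cat; apply/orP/idP=> [[/gens_sub|/gens_sub]//|Sx].
by rewrite -(enum_rankK_in Sx Sx) !mem_gens; case: (col _); [left | right].
Qed.

Lemma half_cox_rem i : half_cox (col i) = (e i * \prod_(x <- rem (e i) (gens (col i))) x)%g.
Proof.
rewrite half_cox_gens; apply: prod_rem; first by rewrite mem_gens.
move=> _ /mapP[j + ->]; rewrite mem_colour_class => /eqP eq_col.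
by have [->//|neq_ji] := eqVneq j i; apply/gram0_commute/colP; rewrite 1?eq_sym.
Qed.

(** Multiplying by the prefix reflection of a letter deletes that letter from the word: it commutes
    to the front of its half, and in the second half the conjugation carries it across the first. *)
Lemma bicox_delete i : coxeter_element (S :\ e i) ((e i ^ shiftw i)^-1 * bicox)%g.
Proof.
have uniq_cat := gens_cat_uniq; rewrite cat_uniq in uniq_cat.
have [_ /hasPn disj _] := and3P uniq_cat.
pose r b := if col i == b then rem (e i) (gens b) else gens b.
have mem_r b j : (e j \in r b) = (j != i) && (col j == b).
  rewrite /r; case: ifP => [_|neq_col].
    by rewrite mem_rem_uniq ?gens_uniq // !inE mem_gens (inj_eq enum_val_inj).
  rewrite mem_gens; have [->|//] := eqVneq j i; exact: neq_col.
have r_sub b : {subset r b <= S}.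
  by move=> x; rewrite /r; case: ifP => _; [move/mem_rem|]; apply: gens_sub.
have r_uniq b : uniq (r b) by rewrite /r; case: ifP; rewrite ?rem_uniq ?gens_uniq.
exists (r true ++ r false).
  apply: uniq_perm (enum_uniq _) _.
    rewrite cat_uniq !r_uniq andbT; apply/hasPn=> x rx.
    have Sx := r_sub _ _ rx; move: rx; rewrite /= -(enum_rankK_in Sx Sx) !mem_r.
    by case/andP=> _ /eqP->; rewrite andbF.
  move=> x; rewrite mem_enum mem_cat !inE.
  have [Sx|notSx] := boolP (x \in S); last first.
    by rewrite andbF; apply/norP; split; apply: contra notSx; apply: r_sub.
  rewrite -(enum_rankK_in Sx Sx) !mem_r (inj_eq enum_val_inj) andbT.
  by case: (col _); rewrite ?andbT ?andbF ?orbF.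
rewrite big_cat /= /r /bicox /shiftw; have := half_cox_rem i.
case: (col i) => /= half_cox_i.
  by rewrite conjg1 -half_cox_gens half_cox_i -!mulgA mulKg.
rewrite -half_cox_gens conjgE !invMg !invgK [in LHS]half_cox_i.
rewrite -!mulgA (mulgA (half_cox true) (half_cox true)) half_cox_sqr mul1g mulKg.
by rewrite half_cox_inv.
Qed.

(** The identity is doubled so as to stay in [nat]. Conjugacy of Coxeter elements replaces [c] by
    [bicox] and each [c_ s] by the word with a letter deleted. *)
Lemma coxeter_recursion (h : nat) (c : gT) (c_ : gT -> gT) (j : seq nat) (i : nat) :
    coxeter_number S h -> coxeter_element S c ->
    (forall s, s \in S -> coxeter_element (S :\ s) (c_ s)) ->
    sumn j = #|S| -> (i < size j)%N -> nth 0%N j i = 1%N ->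
  (2 * num_multichains W S c j =
   h * \sum_(s in S) num_multichains <<S :\ s>>%g (S :\ s) (c_ s) (delete_nth i j))%N.
Proof.
move=> [c0 cox_c0 ->] cox_c cox_c_ sumj lt_i ji1.
have normW g : g \in W -> g \in 'N(T)%g by apply/subsetP/reflections_norm.
have [g0 Wg0 def_c0] := coxeter_conj (subxx S) bicox_coxeter cox_c0.
have [g Wg def_c] := coxeter_conj (subxx S) bicox_coxeter cox_c.
rewrite parabolic_multichains // def_c nfactJ ?normW // def_c0 orderJ.
rewrite (nfact_delete _ (reflections_normed S) lt_i) ji1.
rewrite nfact1 ?one_notin_reflections //.
pose f t := nfact T (delete_nth i j) (t^-1 * bicox)%g.
rewrite (bicox_count (f := f)) => [|t Tt]; last first.
  rewrite /f -[RHS](nfactJ (T := T) _ _ (normW _ bicox_mem)).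
  by rewrite conjMg conjVg (conjgE bicox bicox) mulKg.
congr (_ * _)%N; rewrite [RHS]big_enum_val /=; apply: eq_bigr => l _.
have sumj' : sumn (delete_nth i j) = #|S :\ e l|.
  have := cardsD1 (e l) S; rewrite enum_valP -sumj add1n.
  have -> : sumn j = (nth 0%N j i + sumn (delete_nth i j))%N.
    rewrite /delete_nth -{1}(cat_take_drop i j) (drop_nth 0%N lt_i).
    by rewrite !sumn_cat /= addnCA.
  by rewrite ji1 add1n => -[].
have cox_l : coxeter_element (S :\ e l) (c_ (e l)) by apply: cox_c_; apply: enum_valP.
rewrite (parabolic_multichains (subD1set _ _) cox_l sumj').
have [g' Wg' ->] := coxeter_conj (subD1set _ _) (bicox_delete l) cox_l.
by rewrite nfactJ ?normW.
Qed.

End Roots.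

Local Open Scope ring_scope.

Theorem theorem1p1 (gT : finGroupType) (W : {group gT}) (S : {set gT})
    (hWS : coxeter_system W S) (hirr : irreducible_coxeter S)
    (h : nat) (hh : coxeter_number S h)
    (c : gT) (hc : coxeter_element S c)
    (c_ : gT -> gT) (hc_ : forall s, s \in S -> coxeter_element (S :\ s) (c_ s))
    (k : nat) (j : seq nat) (hk : size j = k.+1) (hj : sumn j = #|S|)
    (i : nat) (hi : (i < k.+1)%N) (hji : nth 0%N j i = 1%N) :
  (num_multichains W S c j)%:R =
    h%:R / 2%:R *
    \sum_(s in S)
      (num_multichains <<S :\ s>>%g (S :\ s) (c_ s) (delete_nth i j))%:R :> rat.
Proof.
have [defW S2 univ] := hWS; rewrite -defW in univ; have [_ S_conn] := hirr.
(* The ground field is that of the real algebraic numbers, a real closed field. *)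
have [rho [rhoM rho1 rho_gen]] := geometric_representation algR S2 univ.
pose e (l : 'I_#|S|) : gT := enum_val l.
have [col colP] := forest_colouring (coxeter_leaf S2 rhoM rho1 rho_gen).
have col_gram l m : l != m -> col (e l) = col (e m) -> gram algR S l m = 0.
  move=> neq_lm eq_col; apply/eqP; rewrite (gram_eq0 algR S2 neq_lm).
  apply: contra_eqT eq_col => ncomm; apply: colP; rewrite ?enum_valP //.
  by rewrite (inj_eq enum_val_inj).
(* Irreducibility, transferred from paths in the Coxeter graph to nonzero entries of [adj]. *)
have conn l m : connect [rel l m | adj algR S l m != 0] l m.
  have /connectP[p] := S_conn _ _ (enum_valP l) (enum_valP m).
  elim: p l => [|x p IHp] l /=; first by move=> _ /enum_val_inj->; apply: connect0.
  case/andP=> /and3P[_ Sx m_gt2] path_p last_p.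
  have def_x : x = e (enum_rank_in Sx x) by rewrite /e enum_rankK_in.
  set l' := enum_rank_in Sx x in def_x; rewrite def_x in path_p last_p m_gt2.
  apply: connect_trans (IHp l' path_p last_p); apply: connect1 => /=.
  have neq_ll' : l != l'.
    apply: contraTneq m_gt2 => ->; rewrite -leqNgt.
    by rewrite /e (gen_sqr S2) order1.
  by rewrite adj_off // oppr_eq0 (gram_neq0 algR S2 neq_ll').
have szj : (i < size j)%N by rewrite hk.
have := coxeter_recursion S2 rhoM rho1 rho_gen col_gram conn hh hc hc_ hj szj hji.
rewrite defW => /(congr1 (fun m : nat => m%:R : rat)); rewrite !natrM natr_sum.
move=> eq2; rewrite mulrAC -eq2 mulrAC divff ?mul1r //.
Qed.
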